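(* Let $X_1,\dots,X_n$ be a sample from a stationary $\beta$-mixing sequence of $\mathbb{R}^d$-valued random variables with stationary (marginal) density $f$ and $\beta$-mixing coefficients $\beta(\cdot)$. Let $$\widehat f(x)=\frac{1}{nh^d}\sum_{i=1}^n I(X_i\in B(x))$$ be the histogram density estimator, where $B(x)$ is the bin containing $x$ in a grid of cubic bins with side length $h>0$ and $I$ is the indicator function. Then for all $\epsilon>\mathbb{E}\left[\int|\widehat f-f|\right]$ and any natural numbers $m$ and $\mu$ such that $2m\mu\le n$, $$\mathbb{P}\left(\int|\widehat f-f|>\epsilon\right)\le 2\exp\left\{-\frac{\mu\epsilon_1^2}{2}\right\}+2\mu\beta(m),$$ where $\epsilon_1=\epsilon-\mathbb{E}\left[\int|\widehat f-f|\right]$.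
   Context: A sequence $\{X_t\}_{t\in\mathbb{Z}}$ is stationary if all its finite-dimensional laws are invariant under time shifts. Its $\beta$-mixing coefficient at lag $a\in\mathbb{N}$ is $\beta(a)=\|\mathbb{P}_{-\infty:0}\otimes\mathbb{P}_{a:\infty}-\mathbb{P}_{-\infty:0,\,a:\infty}\|_{TV}$, where $\mathbb{P}_{i:j}$ is the law of $(X_t)_{i\le t\le j}$, $\mathbb{P}_{-\infty:0,\,a:\infty}$ is the joint law of $((X_t)_{t\le0},(X_t)_{t\ge a})$, and $\|\nu-\lambda\|_{TV}=\sup_A|\nu(A)-\lambda(A)|$. The sequence is $\beta$-mixing if $\beta(a)\to0$ as $a\to\infty$. *)

(* Defs.v *)
From HB Require Import structures.
From mathcomp Require Export all_boot all_order all_algebra.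
From mathcomp Require Export all_classical all_reals all_analysis.
Export Order.TTheory GRing.Theory Num.Theory numFieldNormedType.Exports.

Set Implicit Arguments.
Unset Strict Implicit.
Unset Printing Implicit Defensive.

Local Open Scope classical_set_scope.
Local Open Scope ring_scope.

(* R^d is the type d.-tuple R with its library product sigma-algebra, which is
   the Borel one; Lebesgue measure on it is the d-fold product of the
   one-dimensional Lebesgue measure. *)
Section lebesgue_Rd.
Local Open Scope ereal_scope.
Context {R : realType}.

Definition cons_pair n (p : R * n.-tuple R) : n.+1.-tuple R :=
  [tuple of p.1 :: p.2].

Lemma measurable_cons_pair n : measurable_fun setT (@cons_pair n).
Proof. exact: measurable_cons. Qed.

HB.instance Definition _ n :=
  isMeasurableFun.Build _ _ _ _ (@cons_pair n) (@measurable_cons_pair n).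

Definition lebesgue_cons n
    (m : {sigma_finite_measure set (n.-tuple R) -> \bar R}) :=
  pushforward (@lebesgue_measure R \x m) (@cons_pair n).

Section lebesgue_cons_measure.
Context n (m : {sigma_finite_measure set (n.-tuple R) -> \bar R}).

Let lebesgue_cons0 : lebesgue_cons m set0 = 0.
Proof. by rewrite /lebesgue_cons /pushforward preimage_set0 measure0. Qed.

Let lebesgue_cons_ge0 A : 0 <= lebesgue_cons m A.
Proof. by rewrite /lebesgue_cons /pushforward measure_ge0. Qed.

Let lebesgue_cons_sigma_additive : semi_sigma_additive (lebesgue_cons m).
Proof.
have mf := @measurable_cons_pair n.
move=> F mF tF mUF; rewrite /lebesgue_cons /pushforward preimage_bigcup.
apply: measure_semi_sigma_additive.
- by move=> k; rewrite -[X in measurable X]setTI; exact: mf.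
- apply/trivIsetP => i j _ _ ij; rewrite -preimage_setI.
  by move/trivIsetP : tF => /(_ _ _ _ _ ij) ->//; rewrite preimage_set0.
- by rewrite -preimage_bigcup -[X in measurable X]setTI; exact: mf.
Qed.

HB.instance Definition _ := isMeasure.Build _ _ _ (lebesgue_cons m)
  lebesgue_cons0 lebesgue_cons_ge0 lebesgue_cons_sigma_additive.

Let lebesgue_cons_sigma_finite : sigma_finite setT (lebesgue_cons m).
Proof.
have /sigma_finiteP[F [TF ndF Foo]] := sigma_finiteT (@lebesgue_measure R).
have /sigma_finiteP[G [TG ndG Goo]] := sigma_finiteT m.
pose S k := [set x : n.+1.-tuple R | F k (thead x) /\ G k [tuple of behead x]].
exists S.
  apply/esym; rewrite -subTset => x _.
  have [i _ Fi] : (\bigcup_i F i) (thead x) by rewrite -TF.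
  have [j _ Gj] : (\bigcup_i G i) [tuple of behead x] by rewrite -TG.
  exists (maxn i j) => //; split.
    by move: Fi; exact/subsetPset/ndF/leq_maxl.
  by move: Gj; exact/subsetPset/ndG/leq_maxr.
move=> k; have [mF Fk] := Foo k; have [mG Gk] := Goo k; split.
  apply: measurableI; rewrite -[X in measurable X]setTI.
    exact: (@measurable_tnth _ R n.+1 ord0 measurableT _ mF).
  exact: (@measurable_behead _ R n measurableT _ mG).
rewrite /lebesgue_cons /pushforward (_ : _ @^-1` S k = F k `*` G k).
  by rewrite product_measure1E// lte_mul_pinfty// ge0_fin_numE.
have bK a x : [tuple of behead (cons_pair (a, x))] = x :> n.-tuple R.
  exact: val_inj.
by apply/seteqP; split => -[a x]; rewrite /S /= bK.
Qed.

HB.instance Definition _ := Measure_isSigmaFinite.Build _ _ _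
  (lebesgue_cons m) lebesgue_cons_sigma_finite.

End lebesgue_cons_measure.

Fixpoint lebesgue_tuple n : {sigma_finite_measure set (n.-tuple R) -> \bar R} :=
  match n with
  | 0 => \d_([tuple] : 0.-tuple R)
  | n'.+1 => lebesgue_cons (lebesgue_tuple n')
  end.

Lemma lebesgue_tuple_box n (A : 'I_n -> set R) :
  (forall i, measurable (A i)) ->
  lebesgue_tuple n [set x | forall i, A i (tnth x i)] =
  \prod_(i < n) lebesgue_measure (A i).
Proof.
elim: n A => [|n IH] A mA.
  rewrite big_ord0 /= /dirac indicE mem_set//=; by case.
rewrite big_ord_recl -(IH (fun i => A (lift ord0 i)))// -product_measure1E//=.
  rewrite /lebesgue_cons /pushforward; congr (_ _).
  apply/seteqP; split => -[a x] /=.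
    by move=> Aax; split => [|i]; [exact: (Aax ord0)|
      rewrite -(tnthS a x i); exact: (Aax (lift ord0 i))].
  move=> [Aa Ax] i; case: (unliftP ord0 i) => [j ->|->] //.
  by rewrite /cons_pair tnthS; exact: Ax.
  exact: mA.
rewrite (_ : mkset _ =
    \bigcap_(i in setT) ((@tnth n R) ^~ i @^-1` A (lift ord0 i))).
  apply: fin_bigcap_measurable => // i _.
  by rewrite -[X in measurable X]setTI; exact: measurable_tnth.
by apply/seteqP; split => x /= H i => [_|]; exact: H.
Qed.

End lebesgue_Rd.
Arguments lebesgue_tuple {R} n.

Definition total_variation d (T : measurableType d) (R : realType)
    (nu lam : set T -> \bar R) : \bar R :=
  ereal_sup [set `|nu A - lam A|%E | A in measurable].

(* I -> E with the product sigma-algebra (generated by the coordinate maps). *)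
Definition coordinate_sets (I : Type) d (E : measurableType d) :
    set (set (I -> E)) :=
  \bigcup_(i in [set: I]) preimage_set_system setT (fun p => p i) measurable.

Notation pathspace I E := (g_sigma_algebraType (@coordinate_sets I _ E)).

Section process.
Context {d0} {Omega : measurableType d0} {R : realType} {P : probability Omega R}.
Context {d1} {E : measurableType d1}.
Variable X : int -> {RV P >-> E}.

Definition trajectory (I : Type) (t : I -> int) : Omega -> pathspace I E :=
  fun w i => X (t i) w.

Lemma measurable_trajectory I (t : I -> int) :
  measurable_fun setT (trajectory t).
Proof.
apply: (@measurability _ _ _ _ setT (trajectory t) (@coordinate_sets I _ E)) => //.
move=> _ [_ [i _ [B mB <-]] <-].
rewrite !setTI -comp_preimage -[X in measurable X]setTI.
exact: (@measurable_funPT _ _ _ _ (X (t i))).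
Qed.

HB.instance Definition _ I (t : I -> int) :=
  isMeasurableFun.Build _ _ _ _ (trajectory t) (@measurable_trajectory I t).

Definition stationary := forall (k : nat) (t : 'I_k -> int) (s : int)
    (A : set (pathspace 'I_k E)), measurable A ->
  distribution P (trajectory (fun i => t i + s)) A =
  distribution P (trajectory t) A.

Definition past : Omega -> pathspace {t : int | t <= 0} E :=
  trajectory (fun t => val t).

Definition future (a : nat) : Omega -> pathspace {t : int | a%:Z <= t} E :=
  trajectory (fun t => val t).

Arguments future : clear implicits.

HB.instance Definition _ := MeasurableFun.on past.
HB.instance Definition _ a := MeasurableFun.on (future a).

Definition past_future a w := (past w, future a w).

Lemma measurable_past_future a : measurable_fun setT (past_future a).
Proof. by apply: measurable_fun_pair => /=; exact: measurable_funPT. Qed.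

HB.instance Definition _ a :=
  isMeasurableFun.Build _ _ _ _ (past_future a) (@measurable_past_future a).

Definition beta (a : nat) : \bar R :=
  total_variation (distribution P past \x distribution P (future a))%E
    (distribution P (past_future a)).

Definition beta_mixing := beta @ \oo --> 0%E.

End process.

Section density_estimation.
Context {R : realType} {d : nat}.
Implicit Types (f : d.-tuple R -> R) (h : R) (o x : d.-tuple R).

Definition is_density (mu : set (d.-tuple R) -> \bar R) f :=
  [/\ measurable_fun setT f, forall x, 0 <= f x &
      forall A, measurable A ->
        mu A = (\int[lebesgue_tuple d]_(x in A) (f x)%:E)%E].

(* Bin containing x, in the grid of half-open cubes of side h having a vertex
   at o. *)
Definition bin o h x : set (d.-tuple R) :=
  [set y | forall i, Num.floor ((tnth y i - tnth o i) / h) =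
                     Num.floor ((tnth x i - tnth o i) / h)].

Definition histogram o h n (x_ : 'I_n -> d.-tuple R) x : R :=
  (n%:R * h ^+ d)^-1 * \sum_(i < n) \1_(bin o h x) (x_ i).

Definition L1_dist (g f : d.-tuple R -> R) : \bar R :=
  (\int[lebesgue_tuple d]_x `|g x - f x|%:E)%E.

End density_estimation.

(* Main.v *)
(* Let G be the L1 error as a function of the bins of X_1, ..., X_n (it moves by
   at most 2/n when one of them changes), p = P(G > eps), D = 1_(G > eps) / p,
   and N_k = E[D | X_1, ..., X_k]. Then eps_1 <= E[D G] - E[G], and this is
   bounded from above by a transport argument: 2m (E[D G] - E[G]) is the sum
   over c of E[(N_(c+2m) - N_c) G]. In each window, G is replaced by its infimum
   over the m - 1 central coordinates, and this hole is then widened one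
   coordinate at a time to the right and to the left. Each replacement costs 2/n
   times a total variation E[(N_l - N_k)^+], and by Pinsker's inequality these
   are controlled by entropy increments, whose total is at most ln (1/p). What
   remains are expectations of N_k H where H ignores the m - 1 coordinates after
   the k-th one. By beta-mixing the coordinates before such a hole can be made
   independent of those after it, at the cost of beta(m)/p times the oscillation
   of H, and after this the remaining terms telescope away. The outcome is
     eps_1 <= sqrt(m/(2n) ln(1/p)) (sqrt 2 + 4/3 - (sqrt 2 - 1)/m)
              + (4 - (5m - 1)/n) beta(m)/p,
   which implies the tail bound when mu >= 2. For mu = 1 Markov's inequality
   suffices, and beta(0) = 1 because a law with a density has no atoms. The
   argument is run for finitely many bins, the others being lumped together,
   and the number of bins then tends to infinity. *)
Require Import Defs.
From mathcomp Require Import ring lra zify measurable_realfun.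

Local Open Scope classical_set_scope.
Local Open Scope ring_scope.

(** * Numerical inequalities *)

Section numeric.
Context {R : realType}.
Implicit Types (x y z t : R).

(** As [1 - s <= exp (- s)], the [2^k]-th power of [1 - t / 2^k] is at most [exp (- t)]. Computing
    this power by [k] squarings reduces a bound on a logarithm to arithmetic. *)
Lemma ln_ge_iter_sqr t x k : 0 < x -> t < 2 ^+ k ->
  x^-1 <= iter k (fun y => y ^+ 2) (1 - t / 2 ^+ k) -> t <= ln x.
Proof.
move=> x0 tk; have k0 : (0 : R) < 2 ^+ k by rewrite exprn_gt0.
have -> : iter k (fun y => y ^+ 2) (1 - t / 2 ^+ k) = (1 - t / 2 ^+ k) ^+ (2 ^ k).
  by elim: (k) (1 - _) => // j IH y; rewrite iterS IH -exprM -expnSr.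
move=> h; rewrite -[t]expRK ler_ln ?posrE ?expR_gt0//.
rewrite -lef_pV2 ?posrE ?expR_gt0// (le_trans h)// -expRN.
have -> : - t = (2 ^ k)%N%:R * - (t / 2 ^+ k).
  by rewrite natrX mulrN mulrCA divff ?mulr1// gt_eqF.
rewrite expRM_natl lerXn2r ?nnegrE ?expR_ge0 ?expR_ge1Dx//.
by rewrite subr_ge0 ler_pdivrMr// mul1r ltW.
Qed.

(** Allows each squaring in the chains below to be rounded down, so that the decimals stay short. *)
Lemma ler_sqr_trans (a b x : R) : 0 <= a -> a <= x -> b <= a ^+ 2 -> b <= x ^+ 2.
Proof. by move=> a0 ax; nra. Qed.

(* The constants are lower bounds on [(1 - 0.69 / 2^7)^(2^j)]. *)
Lemma ln2_ge : 69 / 100 <= ln 2 :> R.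
Proof.
have p0 : (2 : R) ^+ 7 = 128 by rewrite -natrX.
apply: (@ln_ge_iter_sqr _ _ 7); rewrite ?p0; [lra|lra|].
rewrite /=.
apply: (@ler_sqr_trans ((70 + 724 / 1000) / 100)); [lra| |lra].
apply: (@ler_sqr_trans ((84 + 98 / 1000) / 100)); [lra| |lra].
apply: (@ler_sqr_trans ((91 + 705 / 1000) / 100)); [lra| |lra].
apply: (@ler_sqr_trans ((95 + 763 / 1000) / 100)); [lra| |lra].
apply: (@ler_sqr_trans ((97 + 859 / 1000) / 100)); [lra| |lra].
apply: (@ler_sqr_trans ((98 + 924 / 1000) / 100)); [lra| |lra].
lra.
Qed.

Lemma ln3_ge : 109 / 100 <= ln 3 :> R.
Proof.
have p0 : (2 : R) ^+ 7 = 128 by rewrite -natrX.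
apply: (@ln_ge_iter_sqr _ _ 7); rewrite ?p0; [lra|lra|].
rewrite /=.
apply: (@ler_sqr_trans ((57 + 836 / 1000) / 100)); [lra| |lra].
apply: (@ler_sqr_trans ((76 + 50 / 1000) / 100)); [lra| |lra].
apply: (@ler_sqr_trans ((87 + 207 / 1000) / 100)); [lra| |lra].
apply: (@ler_sqr_trans ((93 + 385 / 1000) / 100)); [lra| |lra].
apply: (@ler_sqr_trans ((96 + 636 / 1000) / 100)); [lra| |lra].
apply: (@ler_sqr_trans ((98 + 304 / 1000) / 100)); [lra| |lra].
lra.
Qed.

(* Tangent lines of the convex function [t |-> ln 2 - ln (1 - t)]. *)
Lemma ln_tangent (c t : R) : 0 < c -> t < 1 ->
  ln c + c * t - c + 1 <= - ln (1 - t) .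
Proof.
move=> c0 t1; have t10 : 0 < 1 - t by lra.
have := @le_ln1Dx R (c * (1 - t) - 1); rewrite addrCA subrr addr0.
rewrite lnM ?posrE// => /(_ _).
have : 0 < c * (1 - t) by rewrite mulr_gt0.
by move=> h /(_ ltac:(lra)); lra.
Qed.

Lemma log_tangents t : 0 <= t < 1 ->
  let r := ln 2 - ln (1 - t) in
  [/\ 69 / 100 + t <= r, 2 * t + 38 / 100 <= r, 3 * t - 22 / 100 <= r &
      4 * t - 93 / 100 <= r].
Proof.
move=> /andP[t0 t1] r.
have l2 := ln2_ge; have l3 := ln3_ge.
have l1 := @ln_tangent 1 t ltr01 t1.
have h2 := @ln_tangent 2 t ltac:(lra) t1.
have h3 := @ln_tangent 3 t ltac:(lra) t1.
have h4 := @ln_tangent 4 t ltac:(lra) t1.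
have e4 : ln 4 = ln 2 + ln 2 :> R.
  by rewrite -lnM ?posrE//; congr ln; lra.
rewrite ln1 in l1.
by rewrite /r; split; lra.
Qed.

(* Squaring the negated conclusion gives a quadratic inequality in [z]; the last
   hypothesis refutes it at [z = Z], which is the worst case. *)
Lemma quad_gt (u Z z l a K t r : R) :
  2 <= u -> 0 < Z -> Z ^+ 2 = 2 * u -> 0 <= z <= Z -> 0 <= l ->
  l ^+ 2 < z ^+ 2 - r -> 0 <= t -> 2 * t <= r -> t ^+ 2 <= r -> 0 <= K <= 4 ->
  0 <= a < 1 ->
  0 < 2 * u * (1 - a ^+ 2) + a ^+ 2 * r + K ^+ 2 * t ^+ 2 / (8 * u) - K * t ->
  a * l + K * t / (2 * Z) < z.
Proof.
move=> u2 Z0 Zu /andP[z0 zZ] l0 lz t0 tr t2r /andP[K0 K4] /andP[a0 a1] Q.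
rewrite ltNge; apply/negP => zl.
pose b := K * t / (2 * Z).
have b0 : 0 <= b by rewrite /b divr_ge0// ?mulr_ge0// ltW.
have bZ : b * Z = K * t / 2 by rewrite /b; field; rewrite gt_eqF.
have b2 : b ^+ 2 = K ^+ 2 * t ^+ 2 / (8 * u).
  rewrite /b expr_div_n !exprMn Zu; field; lra.
have b2r : b ^+ 2 <= r.
  rewrite b2 (le_trans _ t2r)// ler_pdivrMr; last by lra.
  have K16 : K ^+ 2 <= 8 * u by nra.
  by rewrite mulrC ler_wpM2l ?sqr_ge0.
have zb : b < z.
  by rewrite -(@ltr_pXn2r _ 2)// ?nnegrE//; have := sqr_ge0 l; lra.
have q0 : (z - b) ^+ 2 < a ^+ 2 * (z ^+ 2 - r) \/ a = 0.
  have [->|an0] := eqVneq a 0; first by right.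
  left; apply: (@le_lt_trans _ _ ((a * l) ^+ 2)).
    rewrite ler_pXn2r ?nnegrE ?mulr_ge0//; last by lra.
    by rewrite /b; lra.
  by rewrite exprMn ltr_pM2l// exprn_gt0// lt_neqAle eq_sym an0.
case: q0 => [q0|a_eq0]; last by move: zl zb; rewrite a_eq0 mul0r /b; lra.
have {}Q : 0 < Z ^+ 2 * (1 - a ^+ 2) + a ^+ 2 * r + b ^+ 2 - 2 * b * Z.
  have e : 2 * b * Z = K * t by rewrite -mulrA bZ; lra.
  by rewrite Zu b2 e; lra.
have a21 : a ^+ 2 < 1 by rewrite expr_lt1.
(* The quadratic [(1 - a^2) z^2 - 2 b z + b^2 + a^2 r] is negative at [z] and positive at [Z]. If
   its vertex is at or beyond [Z], it decreases on [[z, Z]]; otherwise [b] is so small that its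
   discriminant is not positive. *)
have [v|v] := lerP ((1 - a ^+ 2) * Z) b.
  have : 0 <= (Z - z) * (2 * b - (1 - a ^+ 2) * (z + Z)).
    apply: mulr_ge0; first by lra.
    have : 0 <= (1 - a ^+ 2) * (Z - z) by apply: mulr_ge0; lra.
    by lra.
  by lra.
have br : b ^+ 2 <= (1 - a ^+ 2) * r.
  have h1 : b * b <= (1 - a ^+ 2) * (K * t / 2).
    by rewrite -bZ (mulrCA (1 - a ^+ 2)); apply: ler_wpM2l => //; lra.
  have h2 : (1 - a ^+ 2) * (K * t / 2) <= (1 - a ^+ 2) * r.
    by apply: ler_wpM2l; nra.
  by lra.
have := sqr_ge0 ((1 - a ^+ 2) * z - b).
have : 0 <= a ^+ 2 * ((1 - a ^+ 2) * r - b ^+ 2).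
  by apply: mulr_ge0; rewrite ?sqr_ge0//; lra.
have : 0 < (1 - a ^+ 2) * (a ^+ 2 * (z ^+ 2 - r) - (z - b) ^+ 2).
  by apply: mulr_gt0; lra.
by lra.
Qed.

(** The last hypothesis of [quad_gt] in the case [i = 0] of [deviation_lt1]. For [u >= 13] the first
    term is large enough; the other values of [u] are treated one at a time. *)
Lemma margin0 (u : nat) (t r : R) : (2 <= u)%N -> 0 <= t < 1 ->
  2 * t + 38 / 100 <= r -> 3 * t - 22 / 100 <= r -> 4 * t - 93 / 100 <= r ->
  forall K, K = 4 - 5 / (2 * u%:R) ->
  0 < 2 * u%:R * (1 - (1943 / 2000) ^+ 2) + (1943 / 2000) ^+ 2 * r
        + K ^+ 2 * t ^+ 2 / (8 * u%:R) - K * t.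
Proof.
move=> u2 /andP[t0 t1] r2 r3 r4 K eK.
have [u13|u13] := leqP 13 u.
  have u13R : 13 <= u%:R :> R by rewrite ler_nat.
  have u0 : (0 : R) < u%:R by lra.
  have : 0 <= K ^+ 2 * t ^+ 2 / (8 * u%:R).
    by apply: divr_ge0; [apply: mulr_ge0; exact: sqr_ge0|lra].
  have K4 : K <= 4 by rewrite eK gerBl divr_ge0//; lra.
  have : K * t <= 4 * t by rewrite ler_wpM2r.
  by lra.
(* These squares give tangents to [t^2], after which each remaining value of [u] is a matter of
   linear arithmetic. *)
have := sqr_ge0 (t - 3 / 5); have := sqr_ge0 (t - 7 / 10).
have := sqr_ge0 (t - 4 / 5).
rewrite eK; clear K eK.
have : u \in [:: 2; 3; 4; 5; 6; 7; 8; 9; 10; 11; 12]%N.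
  by rewrite -[X in _ \in X]/(iota 2 11) mem_iota u2.
by rewrite !inE; do ?[case/orP]; move/eqP => {u u2 u13}->; lra.
Qed.

(** The case [i = 1], where the margin is wide enough for splitting the range of [u] at 3 and 5
    only. *)
Lemma margin1 (u t r : R) : 2 <= u -> 0 <= t < 1 ->
  2 * t + 38 / 100 <= r -> 3 * t - 22 / 100 <= r -> 
  forall K, K = 4 - 2 / u ->
  0 < 2 * u * (1 - (33 / 40) ^+ 2) + (33 / 40) ^+ 2 * r
        + K ^+ 2 * t ^+ 2 / (8 * u) - K * t.
Proof.
move=> u2 /andP[t0 t1] r2 r3 K eK.
have : 0 <= K ^+ 2 * t ^+ 2 / (8 * u).
  by apply: divr_ge0; [apply: mulr_ge0; exact: sqr_ge0|lra].
have Kt x : K <= x -> K * t <= x * t by move=> ?; rewrite ler_wpM2r.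
have iu x : 0 < x -> u <= x -> x^-1 <= u^-1.
  by move=> x0 ux; rewrite lef_pV2// posrE; lra.
have iu2 : u^-1 <= 2^-1 by rewrite lef_pV2// posrE; lra.
have iu0 : 0 < u^-1 by rewrite invr_gt0; lra.
have [u5|/ltW u5] := leP 5 u; first by have := Kt 4; rewrite eK; lra.
have := iu 5 ltac:(lra) u5 => i5.
have [u3|/ltW u3] := leP 3 u; first by have := Kt (18 / 5); rewrite eK; lra.
have := iu 3 ltac:(lra) u3 => i3.
have K3 : 3 <= K by rewrite eK; lra.
have : 9 * t ^+ 2 / 24 <= K ^+ 2 * t ^+ 2 / (8 * u).
  apply: ler_pM; [by have := sqr_ge0 t; lra|by rewrite invr_ge0| |].
    by rewrite ler_wpM2r ?sqr_ge0//; nra.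
  by rewrite lef_pV2 ?posrE; lra.
have := Kt (10 / 3); have := sqr_ge0 (t - 1); rewrite eK; lra.
Qed.

End numeric.

(** * From a bound on the deviation to a bound on the tail probability *)

Section numeric2.
Context {R : realType}.

(** The convex function [t^2] lies below its chords on [[0, 3/5]] and [[3/5, 1]]. The constant is
    [(13/8)^2], as required by [deviation_lt]. *)
Lemma tangents_sqr (t r : R) : 0 <= t < 1 -> 2 * t + 38 / 100 <= r ->
  4 * t - 93 / 100 <= r -> 169 / 64 * t ^+ 2 <= r.
Proof.
move=> /andP[t0 t1] r2 r4; have [t6|/ltW t6] := leP t (3 / 5).
  have : t * t <= 3 / 5 * t by rewrite ler_wpM2r.
  by lra.
have : 0 <= (t - 3 / 5) * (1 - t) by apply: mulr_ge0; lra.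
by lra.
Qed.

Lemma sqr_nneg_inj (x y : R) : 0 <= x -> 0 <= y -> x ^+ 2 = y ^+ 2 -> x = y.
Proof. by move=> x0 y0 /eqP; rewrite eqrXn2// => /eqP. Qed.

Lemma sqrt2_bounds : 0 < Num.sqrt (2 : R) < 99 / 70.
Proof.
rewrite sqrtr_gt0 ltr0n/= -(@ltr_pXn2r _ 2)// ?nnegrE ?sqrtr_ge0 ?sqr_sqrtr//.
by lra.
Qed.

(* The left-hand side is affine in [i], so it suffices to take [i = 0] and
   [i = 1], where [1/2 + q/3 <= 1943/2000] and [7/12 q <= 33/40]. *)
Lemma deviation_lt1 (mu : nat) (Z z l t r i q : R) :
  let u : R := mu%:R in
  (2 <= mu)%N -> 0 < Z -> Z ^+ 2 = 2 * u -> 0 <= z <= Z -> 0 <= l ->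
  l ^+ 2 < z ^+ 2 - r -> 0 <= t < 1 ->
  2 * t + 38 / 100 <= r -> 3 * t - 22 / 100 <= r -> 4 * t - 93 / 100 <= r ->
  0 < i <= 1 -> 0 < q < 99 / 70 ->
  l * (1 / 2 + q / 3 - (1 / 2 - q / 4) * i)
    + (4 - (5 - i) / (2 * u)) * t / (2 * Z) < z.
Proof.
move=> u mu2 Z0 Z2 zz l0 zM tt s2 s3 s4 /andP[i0 i1] /andP[q0 q1].
have u2 : 2 <= u by rewrite ler_nat.
have t0 : 0 <= t by case/andP: tt.
have t2r : t ^+ 2 <= r.
  have := @tangents_sqr _ _ tt s2 s4; have := sqr_ge0 t.
  by clear; lra.
have tr : 2 * t <= r by move: s2; clear; lra.
have iu : u^-1 <= 2^-1 by rewrite lef_pV2 ?posrE//; move: u2; clear; lra.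
have iu0 : 0 < u^-1 by rewrite invr_gt0; move: u2; clear; lra.
have K0 : 0 <= 4 - 5 / (2 * u) <= 4.
  by rewrite invfM mulrA; move: iu iu0; clear; lra.
have K1 : 0 <= 4 - 2 / u <= 4 by move: iu iu0; clear; lra.
have a0 : 0 <= (1943 / 2000 : R) < 1 by clear; lra.
have a1 : 0 <= (33 / 40 : R) < 1 by clear; lra.
have h0 := @quad_gt _ u Z z l _ _ t r u2 Z0 Z2 zz l0 zM t0 tr t2r K0 a0
  (@margin0 _ _ _ _ mu2 tt s2 s3 s4 _ erefl).
have h1 := @quad_gt _ u Z z l _ _ t r u2 Z0 Z2 zz l0 zM t0 tr t2r K1 a1
  (@margin1 _ _ _ _ u2 tt s2 s3 _ erefl).
have k0 : l * (1 / 2 + q / 3) <= 1943 / 2000 * l.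
  by rewrite mulrC ler_wpM2r//; move: q1; clear; lra.
have k1 : l * (7 / 12 * q) <= 33 / 40 * l.
  by rewrite mulrC ler_wpM2r//; move: q1; clear; lra.
have {}h0 := le_lt_trans (lerD k0 (lexx _)) h0.
have {}h1 := le_lt_trans (lerD k1 (lexx _)) h1.
have -> : l * (1 / 2 + q / 3 - (1 / 2 - q / 4) * i) +
      (4 - (5 - i) / (2 * u)) * t / (2 * Z) =
    (1 - i) * (l * (1 / 2 + q / 3) + (4 - 5 / (2 * u)) * t / (2 * Z))
    + i * (l * (7 / 12 * q) + (4 - 2 / u) * t / (2 * Z)).
  by field; rewrite !gt_eqF//; move: u2; clear; lra.
move: h0 h1; set A0 := l * (1 / 2 + _) + _; set A1 := l * (7 / 12 * q) + _.
clearbody A0 A1; rewrite -subr_gt0 => h0; rewrite -subr_gt0 => h1.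
have : 0 <= (1 - i) * (z - A0) by rewrite mulr_ge0 ?(ltW h0)// subr_ge0.
have : 0 < i * (z - A1) by rewrite mulr_gt0.
by clear; lra.
Qed.

(** Reduction to [v = 1]. The left-hand side is concave in [v], and its derivative at [v = 1] is
    nonnegative unless [l] is small compared with [t]. *)
Lemma deviation_lt (mu : nat) (Z z l t r v i q : R) :
  let u : R := mu%:R in let a := 1 / 2 + q / 3 - (1 / 2 - q / 4) * i in
  (2 <= mu)%N -> 0 < Z -> Z ^+ 2 = 2 * u -> 0 <= z <= Z -> 0 <= l ->
  l ^+ 2 < z ^+ 2 - r -> 0 <= t < 1 ->
  2 * t + 38 / 100 <= r -> 3 * t - 22 / 100 <= r -> 4 * t - 93 / 100 <= r ->
  0 <= v <= 1 -> 0 < i <= 1 -> 0 < q < 99 / 70 ->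
  v * l * a + (4 - (5 - i) * v ^+ 2 / (2 * u)) * t / (2 * Z) < z.
Proof.
move=> u a mu2 Z0 Z2 zz l0 zM tt s2 s3 s4 /andP[v0 v1] /andP[i0 i1] /andP[q0 q1].
have u2 : 2 <= u by rewrite ler_nat.
rewrite ltNge; apply/negP => hz.
have [/andP[z0 zZ] /andP[t0 t1]] := (zz, tt).
have a0 : 0 <= a.
  have : 0 <= (1 - i) * (1 / 2 - q / 4) by apply: mulr_ge0; lra.
  by rewrite /a; lra.
(* When [l] is small, [z <= 13/4 t / Z]; squaring and using [u >= 2] gives [z^2 <= r] by
   [tangents_sqr], which leaves no room for [l^2]. *)
have [c|c] := leP ((5 - i) * t) (l * a * (2 * Z * u)); last first.
  have lt_zt : z <= 13 / 4 * t / Z.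
    apply: le_trans hz _.
    have la : l * a <= 5 / 4 * t / Z.
      rewrite ler_pdivlMr//; have : (5 - i) * t <= 5 * t by rewrite ler_wpM2r//; lra.
      have : 0 <= l * a * Z * (u - 2) by rewrite !mulr_ge0 ?(ltW Z0)//; lra.
      by lra.
    have : v * l * a <= l * a by rewrite -mulrA ler_piMl// mulr_ge0.
    have : (4 - (5 - i) * v ^+ 2 / (2 * u)) * t / (2 * Z) <= 2 * t / Z.
      rewrite (_ : 2 * t / Z = 4 * t / (2 * Z)); last by field; rewrite gt_eqF.
      rewrite ler_wpM2r ?invr_ge0 ?ler_wpM2r//; first by lra.
      by rewrite gerBl divr_ge0 ?mulr_ge0 ?sqr_ge0//; lra.
    by lra.
  have := @tangents_sqr _ _ tt s2 s4.
  have : z ^+ 2 <= (13 / 4 * t / Z) ^+ 2.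
    by rewrite ler_pXn2r// nnegrE// !mulr_ge0 ?invr_ge0 ?(ltW Z0).
  rewrite expr_div_n Z2 exprMn ler_pdivlMr; last by lra.
  have : 0 <= z ^+ 2 * (u - 2) by rewrite mulr_ge0 ?sqr_ge0//; lra.
  have := sqr_ge0 l.
  by lra.
have hz1 : z <= l * a + (4 - (5 - i) / (2 * u)) * t / (2 * Z).
  apply: le_trans hz _; rewrite -subr_ge0.
  have -> : l * a + (4 - (5 - i) / (2 * u)) * t / (2 * Z) -
    (v * l * a + (4 - (5 - i) * v ^+ 2 / (2 * u)) * t / (2 * Z)) =
    (1 - v) * (l * a * (2 * Z * u) - (5 - i) * t * ((1 + v) / 2)) / (2 * Z * u).
    by field; rewrite !gt_eqF//; lra.
  apply: divr_ge0; last by apply: mulr_ge0; lra.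
  apply: mulr_ge0; first by lra.
  have : (5 - i) * t * ((1 + v) / 2) <= (5 - i) * t.
    by rewrite ler_piMr ?mulr_ge0//; lra.
  by lra.
have := @deviation_lt1 mu Z z l t r i q mu2 Z0 Z2 zz l0 zM tt s2 s3 s4.
by rewrite i0 i1 q0 q1 => /(_ isT isT); rewrite ltNge hz1.
Qed.

(* If the conclusion fails then [t = 2 mu b / p < 1] and
   [- ln p < mu e^2 / 2 - (ln 2 - ln (1 - t))]. *)
Lemma tail_of_deviation (m mu n : nat) (p b e : R) :
  (0 < m)%N -> (2 <= mu)%N -> (2 * m * mu <= n)%N -> 0 < p <= 1 -> 0 <= b ->
  0 <= e <= 2 ->
  e <= Num.sqrt (m%:R / n%:R / 2 * - ln p) *
         (Num.sqrt 2 + 4 / 3 - (Num.sqrt 2 - 1) / m%:R)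
       + (4 - (5 * m%:R - 1) / n%:R) * (b / p) ->
  p <= 2 * expR (- (mu%:R * e ^+ 2 / 2)) + (2 * mu)%:R * b.
Proof.
move=> m0 mu2 mn /andP[p0 p1] b0 /andP[e0 e2] h.
rewrite leNgt; apply/negP => pb.
have u2 : 2 <= mu%:R :> R by rewrite ler_nat.
set u : R := mu%:R in u2 h pb *.
have u0 : 0 < u by rewrite (lt_le_trans _ u2).
have M1 : 1 <= m%:R :> R by rewrite ler1n.
have mR0 : 0 < m%:R :> R by rewrite ltr0n.
have n0 : (0 < n)%N by rewrite (leq_trans _ mn)// !muln_gt0 m0/= (ltn_trans _ mu2).
have N0 : 0 < n%:R :> R by rewrite ltr0n.
have mnR : 2 * m%:R * u <= n%:R by rewrite /u -!natrM ler_nat.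
pose t := 2 * u * b / p.
have tp : t * p = 2 * u * b by rewrite /t divfK// gt_eqF.
have t0 : 0 <= t by rewrite divr_ge0 ?mulr_ge0 ?(ltW p0) ?(ltW u0).
set M := u * e ^+ 2 / 2 in pb.
have eM := expR_gt0 (- M).
have t1 : t < 1.
  by rewrite /t ltr_pdivrMr// mul1r; move: pb; rewrite natrM -/u; lra.
have tt : 0 <= t < 1 by rewrite t0 t1.
have [s1 s2 s3 s4] := @log_tangents _ _ tt.
set r := ln 2 - ln (1 - t) in s1 s2 s3 s4.
have L0 : 0 <= - ln p by rewrite oppr_ge0 ln_le0.
have MLr : - ln p < M - r.
  suff : ln (2 * expR (- M)) < ln (p * (1 - t)).
    by rewrite !lnM ?posrE ?subr_gt0// expRK /r; lra.
  rewrite ltr_ln ?posrE ?mulr_gt0 ?subr_gt0//.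
  by move: pb; rewrite natrM -/u mulrBr mulr1 [p * t]mulrC tp; lra.
have M0 : 0 <= M by rewrite divr_ge0// mulr_ge0 ?sqr_ge0// ltW.
(* In these variables, with [i = 1 / m], the hypothesis [h] times [Z / 2] contradicts
   [deviation_lt]. The condition [e <= 2] becomes [z <= Z], and [2 m mu <= n] becomes [v <= 1]. *)
pose z := Num.sqrt M; pose Z := Num.sqrt (2 * u); pose l := Num.sqrt (- ln p).
have z2 : z ^+ 2 = M by rewrite sqr_sqrtr.
have Z2 : Z ^+ 2 = 2 * u by rewrite sqr_sqrtr// mulr_ge0// ltW.
have l2 : l ^+ 2 = - ln p by rewrite sqr_sqrtr.
have z0 : 0 <= z by rewrite sqrtr_ge0.
have l0 : 0 <= l by rewrite sqrtr_ge0.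
have Z0 : 0 < Z by rewrite sqrtr_gt0 mulr_gt0.
have zZ : z <= Z.
  rewrite ler_sqrt ?mulr_ge0 ?(ltW u0)// /M ler_pdivrMr//.
  have -> : 2 * u * 2 = u * 2 ^+ 2 by ring.
  by rewrite ler_pM2l// ler_pXn2r ?nnegrE.
pose i : R := m%:R^-1.
have i0 : 0 < i by rewrite invr_gt0.
have i1 : i <= 1 by rewrite invf_le1.
pose v := Num.sqrt (2 * u * m%:R / n%:R).
have v2 : v ^+ 2 = 2 * u * m%:R / n%:R.
  by rewrite sqr_sqrtr// divr_ge0 ?mulr_ge0 ?(ltW u0).
have v0 : 0 <= v by rewrite sqrtr_ge0.
have v1 : v <= 1.
  rewrite -(@ler_pXn2r _ 2)// ?nnegrE// v2 expr1n ler_pdivrMr// mul1r.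
  by rewrite mulrAC.
have /andP[q0 q1] := sqrt2_bounds.
have q2 : Num.sqrt 2 ^+ 2 = 2 :> R by rewrite sqr_sqrtr.
set q := Num.sqrt 2 : R in q0 q1 q2 h.
pose a := 1 / 2 + q / 3 - (1 / 2 - q / 4) * i.
have hz : z <= v * l * a + (4 - (5 - i) * v ^+ 2 / (2 * u)) * t / (2 * Z).
  have zE : z = Z / 2 * e.
    apply: sqr_nneg_inj => //; first by rewrite mulr_ge0// divr_ge0// ltW.
    by rewrite z2 exprMn expr_div_n Z2 /M; field.
  rewrite zE; apply: le_trans (ler_wpM2l _ h) _; first by rewrite divr_ge0 ?ltW.
  have -> : Num.sqrt (m%:R / n%:R / 2 * - ln p) = v * l / Z / q * 1.
    apply: sqr_nneg_inj; rewrite ?sqrtr_ge0//.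
      by rewrite !mulr_ge0 ?invr_ge0 ?(ltW Z0) ?(ltW q0).
    rewrite sqr_sqrtr; last by rewrite !mulr_ge0 ?invr_ge0// ltW.
    rewrite !exprMn !exprVn l2 v2 Z2 q2; field.
    by rewrite !gt_eqF.
  rewrite mulrDr lerD// le_eqVlt; apply/orP; left; apply/eqP.
    have aE : a = (q + 4 / 3 - (q - 1) / m%:R) / (2 * q).
      apply: (@mulIf _ (2 * q)); first by rewrite gt_eqF// mulr_gt0.
      rewrite divfK; last by rewrite gt_eqF// mulr_gt0.
      have qi : q ^+ 2 * i = 2 * i by rewrite q2.
      by move: qi q2; rewrite /a -/i; clear; lra.
    by rewrite aE; field; rewrite !gt_eqF.
  have -> : b / p = t / Z ^+ 2 by rewrite Z2 /t; field; rewrite !gt_eqF.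
  rewrite v2 /i; field.
  by rewrite !gt_eqF.
have zM : l ^+ 2 < z ^+ 2 - r by rewrite l2 z2.
have := @deviation_lt mu Z z l t r v i q mu2 Z0 Z2 _ l0 zM tt s2 s3 s4 _ _ _.
by rewrite z0 zZ v0 v1 i0 i1 q0 q1 => /(_ isT isT isT isT); rewrite ltNge hz.
Qed.

End numeric2.

(** * Finite sequences of dependent letters *)

Ltac nat_lia :=
  repeat match goal with
  | H : is_true (leq _ _) |- _ => revert H
  | H : is_true (_ || _) |- _ => revert H
  | H : is_true (_ && _) |- _ => revert H
  | H : is_true (~~ _) |- _ => revert H
  end; clear; lia.

Section finite_coupling.
Context {R : realType} {K : finType} {n : nat}.
Local Notation T := {ffun 'I_n -> K}.
Implicit Types (x y z : T) (A B : pred nat) (f g h : T -> R).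
(* Coordinate [i] sits at position [i + S], so that windows of positions can
   extend beyond both ends of the sequence. *)
Variable S : nat.

Definition agree A x y := [forall i : 'I_n, A (i + S)%N ==> (x i == y i)].
Definition depends A f := forall x y, agree A x y -> f x = f y.

Lemma agreeP A x y :
  reflect (forall i : 'I_n, A (i + S)%N -> x i = y i) (agree A x y).
Proof.
by apply: (iffP forallP) => h i; [move/(implyP (h i))/eqP|apply/implyP => /h ->].
Qed.

Lemma agree_refl A x : agree A x x. Proof. exact/agreeP. Qed.

Lemma agree_sym A x y : agree A x y = agree A y x.
Proof. by apply/agreeP/agreeP => h i /h ->. Qed.

Lemma agree_trans A x y z : agree A x y -> agree A y z -> agree A x z.
Proof. by move=> /agreeP h /agreeP h'; apply/agreeP => i Ai; rewrite h// h'. Qed.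

Lemma agree_sub A B x y : (forall p, A p -> B p) -> agree B x y -> agree A x y.
Proof. by move=> AB /agreeP h; apply/agreeP => i /AB /h. Qed.

Lemma depends_sub A B f : (forall p, A p -> B p) -> depends A f -> depends B f.
Proof. by move=> AB h x y xy; apply: h; apply: agree_sub xy. Qed.

Definition splice k x y : T := [ffun i : 'I_n => if (i + S < k)%N then x i else y i].

Variable P : T -> R.
Hypothesis P_ge0 : forall x, 0 <= P x.
Hypothesis P_sum1 : \sum_x P x = 1.

Definition expect f := \sum_x P x * f x.
Local Notation "''E' f" := (expect f) (at level 10, f at level 8).

Lemma expectD f1 f2 : 'E (fun x => f1 x + f2 x) = 'E f1 + 'E f2.
Proof. by rewrite /expect -big_split/=; apply: eq_bigr => x _; rewrite mulrDr. Qed.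

Lemma expectZ c f : 'E (fun x => c * f x) = c * 'E f.
Proof. by rewrite /expect mulr_sumr; apply: eq_bigr => x _; rewrite mulrCA. Qed.

Lemma expectB f1 f2 : 'E (fun x => f1 x - f2 x) = 'E f1 - 'E f2.
Proof.
by rewrite /expect -sumrB; apply: eq_bigr => x _; rewrite mulrBr.
Qed.

Lemma expect_cst c : 'E (fun=> c) = c.
Proof. by rewrite /expect -mulr_suml P_sum1 mul1r. Qed.

Lemma eq_expect f1 f2 : (forall x, 0 < P x -> f1 x = f2 x) -> 'E f1 = 'E f2.
Proof.
move=> h; apply: eq_bigr => x _.
have [->|Px] := eqVneq (P x) 0; first by rewrite !mul0r.
by rewrite h// lt_neqAle eq_sym Px P_ge0.
Qed.

Lemma ler_expect f1 f2 : (forall x, 0 < P x -> f1 x <= f2 x) -> 'E f1 <= 'E f2.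
Proof.
move=> h; apply: ler_sum => x _.
have [->|Px] := eqVneq (P x) 0; first by rewrite !mul0r.
by rewrite ler_wpM2l// h// lt_neqAle eq_sym Px P_ge0.
Qed.

(** Conditional expectation given the coordinates at positions before [k]. On a class of probability
    0 the quotient is 0. *)
Definition cexp k f x :=
  (\sum_(y | agree (fun p => p < k)%N x y) P y * f y) /
  \sum_(y | agree (fun p => p < k)%N x y) P y.

Lemma cexp_depends k f : depends (fun p => p < k)%N (cexp k f).
Proof.
move=> x y xy; rewrite /cexp; congr (_ / _); apply: eq_bigl => z;
  apply/idP/idP => h.
- by apply: agree_trans h; rewrite agree_sym.
- exact: agree_trans h.
- by apply: agree_trans h; rewrite agree_sym.
- exact: agree_trans h.
Qed.

(** Both sides are sums over the pairs of words that agree before [k], taken in the two possible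
    orders. *)
Lemma expect_cexp k f g : depends (fun p => p < k)%N g ->
  'E (fun x => cexp k f x * g x) = 'E (fun x => f x * g x).
Proof.
move=> gk; rewrite /expect /cexp.
pose Z x := \sum_(y | agree (fun p => p < k)%N x y) P y.
have ZE x y : agree (fun p => p < k)%N x y -> Z x = Z y.
  move=> xy; apply: eq_bigl => z; apply/idP/idP => h.
    by apply: agree_trans h; rewrite agree_sym.
  exact: agree_trans h.
transitivity (\sum_x \sum_y if agree (fun p => p < k)%N x y then
    P x * (P y * f y / Z y * g y) else 0).
  apply: eq_bigr => x _; rewrite -big_mkcond/= mulrA mulr_suml mulr_sumr mulr_suml.
  by apply: eq_bigr => y xy; rewrite -/(Z x) (ZE _ _ xy) (gk _ _ xy) -!mulrA.
rewrite exchange_big/=; apply: eq_bigr => y _.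
rewrite -big_mkcond/= -mulr_suml.
have -> : \sum_(x | agree (fun p => p < k)%N x y) P x = Z y.
  by apply: eq_bigl => x; rewrite agree_sym.
(* A class of mass 0 has conditional expectation 0 by convention, but its words have mass 0 as
   well. *)
have [Z0|Z0] := eqVneq (Z y) 0; last by field.
have -> : P y = 0; last by rewrite !mul0r mulr0.
apply/eqP; rewrite eq_le P_ge0 andbT -Z0 /Z (bigD1 y) ?agree_refl//=.
by rewrite lerDl sumr_ge0.
Qed.

Lemma cexp_ge0 k f x : (forall y, 0 <= f y) -> 0 <= cexp k f x.
Proof.
by move=> f0; rewrite divr_ge0 ?sumr_ge0// => y _; rewrite mulr_ge0.
Qed.

Lemma cexp_le k f x c : 0 <= c -> (forall y, f y <= c) -> cexp k f x <= c.
Proof.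
move=> c0 fc; rewrite /cexp.
set Z := \sum_(y | _) P y.
have Z0 : 0 <= Z by rewrite sumr_ge0.
have [->|Zn0] := eqVneq Z 0; first by rewrite invr0 mulr0.
rewrite ler_pdivrMr ?lt_neqAle 1?eq_sym ?Zn0// mulr_sumr ler_sum// => y _.
by rewrite mulrC ler_wpM2r.
Qed.

Lemma cexp_trivial k f x : (k <= S)%N -> cexp k f x = 'E f.
Proof.
move=> kS; rewrite /cexp.
have a y : agree (fun p => p < k)%N x y.
  by apply/agreeP => i; rewrite ltnNge (leq_trans kS)// leq_addl.
rewrite (eq_bigl xpredT)// (eq_bigl (P1 := fun y => agree _ x y) xpredT)//.
by rewrite P_sum1 divr1.
Qed.

Lemma expect_cexp_full k f g : (n + S <= k)%N ->
  'E (fun x => cexp k f x * g x) = 'E (fun x => f x * g x).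
Proof.
move=> nk; apply: expect_cexp => x y /agreeP xy; congr g; apply/ffunP => i.
by apply: xy; rewrite (leq_trans _ nk)// ltn_add2r.
Qed.

(* The coordinates before [k] are made independent of the others. *)
Definition indep_expect k f g :=
  \sum_x \sum_y P x * P y * (f x * g (splice k x y)).

Lemma agree_splicel k x y : agree (fun p => p < k)%N x (splice k x y).
Proof. by apply/agreeP => i ik; rewrite ffunE ik. Qed.

Lemma indep_expectB k f g1 g2 :
  indep_expect k f (fun x => g1 x - g2 x) =
  indep_expect k f g1 - indep_expect k f g2.
Proof.
rewrite /indep_expect -sumrB; apply: eq_bigr => x _.
by rewrite -sumrB; apply: eq_bigr => y _; rewrite !mulrBr.
Qed.

Lemma indep_expect_cst k f c : indep_expect k f (fun=> c) = c * 'E f.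
Proof.
rewrite /indep_expect /expect mulr_sumr; apply: eq_bigr => x _.
rewrite -mulr_suml -mulr_sumr P_sum1 mulr1; ring.
Qed.

Lemma eq_indep_expect k f (g1 g2 : T -> R) : g1 =1 g2 ->
  indep_expect k f g1 = indep_expect k f g2.
Proof.
by move=> e; apply: eq_bigr => x _; apply: eq_bigr => y _; rewrite e.
Qed.

Lemma indep_expect_depends k f g1 : depends (fun p => p < k)%N f ->
  indep_expect k (fun=> 1) (fun x => f x * g1 x) = indep_expect k f g1.
Proof.
move=> fk; apply: eq_bigr => x _; apply: eq_bigr => y _.
by rewrite mul1r (fk _ _ (agree_splicel k x y)).
Qed.

Definition outside a b : pred nat := fun p => ~~ (a <= p < b)%N.

Section mixing_bound.
Variables (k b : nat) (beta : R).
Hypothesis kb : (k <= b)%N.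
Hypothesis mixing : forall A : {set T}, depends (outside k b) (fun x => (x \in A)%:R) ->
  \sum_(x in A) P x <= indep_expect k (fun=> 1) (fun x => (x \in A)%:R) + beta.

(** From events to functions: among the functions with values in [[0, c]], the excess of the joint
    law over the decoupled one is largest for [c] times the indicator of the set where the joint law
    is the larger. *)
Lemma mixing_expect h c : depends (outside k b) h -> (forall x, 0 <= h x <= c) ->
  'E h <= indep_expect k (fun=> 1) h + c * beta.
Proof.
move=> hd hc.
have [x0 _ /andP[_ Px0]] : exists2 x, x \in T & true && (P x != 0).
  have : \sum_x P x != 0 by rewrite P_sum1 oner_eq0.
  have [/existsP[x Px] _|/existsPn h0] := boolP [exists x, P x != 0].
    by exists x.
  by rewrite big1 ?eqxx// => x _; apply/eqP; rewrite -[_ == _]negbK h0.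
have c0 : 0 <= c by have /andP[/le_trans] := hc x0; exact.
(* [er] overwrites the hole by the letters of [x0], which selects one word in each class of words
   equal outside the hole. [J] and [I] are the laws of this representative under the joint and the
   decoupled law; comparing them makes the extremal set [A] depend only on the coordinates outside
   the hole. *)
pose er x : T := [ffun i : 'I_n => if outside k b (i + S)%N then x i else x0 i].
have er_agree x : agree (outside k b) x (er x).
  by apply/agreeP => i oi; rewrite ffunE oi.
have er_dep x y : agree (outside k b) x y -> er x = er y.
  move=> /agreeP xy; apply/ffunP => i; rewrite !ffunE.
  by case: ifP => // /xy.
pose J z := \sum_(x | er x == z) P x.
pose I z := \sum_x \sum_(y | er (splice k x y) == z) P x * P y.
have EJ g : depends (outside k b) g -> 'E g = \sum_z J z * g z.
  move=> gd; rewrite /expect (partition_big er xpredT)//=.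
  apply: eq_bigr => z _; rewrite mulr_suml; apply: eq_bigr => x /eqP <-.
  by rewrite (gd _ _ (er_agree x)).
have EI g : depends (outside k b) g ->
    indep_expect k (fun=> 1) g = \sum_z I z * g z.
  move=> gd; rewrite /indep_expect.
  under [RHS]eq_bigr do rewrite mulr_suml.
  rewrite [RHS]exchange_big/=; apply: eq_bigr => x _.
  rewrite (partition_big (fun y => er (splice k x y)) xpredT)//=.
  apply: eq_bigr => z _; rewrite mulr_suml; apply: eq_bigr => y /eqP <-.
  by rewrite mul1r (gd _ _ (er_agree _)).
pose A : {set T} := [set x | I (er x) < J (er x)]%SET.
have Ad : depends (outside k b) (fun x => (x \in A)%:R).
  by move=> x y xy; rewrite !inE (er_dep _ _ xy).
have mA := mixing _ Ad.
have PA : \sum_(x in A) P x = 'E (fun x => (x \in A)%:R).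
  rewrite /expect big_mkcond; apply: eq_bigr => x _.
  by case: ifP; rewrite ?mulr1 ?mulr0.
rewrite PA EJ// EI// -lerBlDl -sumrB in mA.
rewrite EJ// EI// -lerBlDl -sumrB.
apply: le_trans (ler_wpM2l c0 mA); rewrite mulr_sumr.
apply: ler_sum => z _.
have [ez|nez] := eqVneq (er z) z; last first.
  have J0 : J z = 0.
    rewrite /J big_pred0// => x; apply/eqP => e; case/eqP: nez.
    by rewrite -e; apply/esym/er_dep/er_agree.
  have I0 : I z = 0.
    rewrite /I big1// => x _; rewrite big_pred0// => y; apply/eqP => e.
    by case/eqP: nez; rewrite -e; apply/esym/er_dep/er_agree.
  by rewrite J0 I0 !mul0r subrr mulr0.
rewrite inE ez; have /andP[h0 h1] := hc z.
have [IJ|JI] := ltP (I z) (J z).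
  have : 0 <= (J z - I z) * (c - h z) by apply: mulr_ge0; lra.
  by rewrite /=; lra.
have : 0 <= (I z - J z) * h z by apply: mulr_ge0; lra.
by rewrite /=; lra.
Qed.

End mixing_bound.

End finite_coupling.

(** * Infima of a function over a block of coordinates *)

Section holes.
Context {R : realType} {K : finType} {n : nat}.
Local Notation T := {ffun 'I_n -> K}.
Implicit Types (x y z : T) (A B : pred nat).
Variables (S : nat) (G : T -> R) (w : R).
Hypothesis w_ge0 : 0 <= w.
Hypothesis lipG : forall x y i,
  (forall j, j != i -> x j = y j) -> G x <= G y + w.

(** Infimum of [G] when the coordinates at positions in [[a, b)] vary. The initial value [G x] of
    the minimum adds nothing, because [x] is in the range. *)
Definition inf_hole a b x : R :=
  \big[Num.min/G x]_(z | agree S (outside a b) x z) G z.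
Local Notation hole := inf_hole.

(** Bound on the oscillation of [G] in the coordinate at position [u]; positions off the sequence
    cost nothing. *)
Definition wt u : R := if (S <= u < S + n)%N then w else 0.

Lemma wt_le u : wt u <= w. Proof. by rewrite /wt; case: ifP. Qed.

Lemma hole_le a b x z : agree S (outside a b) x z -> hole a b x <= G z.
Proof. exact: bigmin_le_cond. Qed.

Lemma hole_ge a b x c : (forall z, agree S (outside a b) x z -> c <= G z) ->
  c <= hole a b x.
Proof. by move=> h; apply: le_bigmin => //; apply: h; exact: agree_refl. Qed.

Lemma hole_depends a b : depends S (outside a b) (hole a b).
Proof.
move=> x y xy; apply/eqP; rewrite eq_le; apply/andP; split; apply: hole_ge => z h;
  apply: hole_le; apply: agree_trans h => //.
by rewrite agree_sym.
Qed.

Lemma hole_id a b x : (b <= a)%N -> hole a b x = G x.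
Proof.
move=> ba; apply/eqP; rewrite eq_le hole_le ?agree_refl//=.
apply: hole_ge => z /agreeP xz; rewrite (_ : x = z)//.
apply/ffunP => i; apply: xz; rewrite /outside; nat_lia.
Qed.

Lemma hole_anti a b a' b' x : (a' <= a)%N -> (b <= b')%N ->
  hole a' b' x <= hole a b x.
Proof.
move=> aa bb; apply: hole_ge => z xz; apply: hole_le; apply: agree_sub xz => p.
rewrite /outside; nat_lia.
Qed.

(** A word admissible for the second hole becomes admissible for the first one when its letter at
    [u] is reset to that of [x], which changes [G] by at most [wt u]. *)
Lemma hole_add u a b a' b' x :
  (forall p, a' <= p < b' -> (a <= p < b) || (p == u))%N ->
  hole a b x <= hole a' b' x + wt u.
Proof.
move=> h; rewrite -lerBlDr; apply: hole_ge => z xz; rewrite lerBlDr.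
pose z' : T := [ffun i : 'I_n => if (i + S == u)%N then x i else z i].
have hz' : hole a b x <= G z'.
  apply/hole_le/agreeP => i oi; rewrite ffunE; case: ifPn => // iu.
  move/agreeP: xz; apply; move: oi; rewrite /outside; apply: contra => /h.
  by rewrite (negbTE iu) orbF.
apply: le_trans hz' _; rewrite /wt; case: ifPn => [Su|Su].
  have un : (u - S < n)%N by nat_lia.
  apply: (@lipG _ _ (Ordinal un)) => j ju; rewrite ffunE; case: ifPn => // /eqP e.
  by case/eqP: ju; apply: val_inj => /=; move: e; clear; lia.
rewrite addr0 (_ : z' = z)//; apply/ffunP => i; rewrite ffunE.
case: ifPn => // /eqP iu; case/negP: Su; by have := ltn_ord i; move: iu; clear; lia.
Qed.

Lemma hole_right a b x : hole a b x <= hole a b.+1 x + wt b.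
Proof. by apply: hole_add => p; nat_lia. Qed.

Lemma hole_left a b x : hole a.+1 b x <= hole a b x + wt a.
Proof. by apply: hole_add => p; nat_lia. Qed.

Lemma hole_right_sum a b k x :
  hole a b x <= hole a (b + k) x + \sum_(j < k) wt (b + j).
Proof.
elim: k => [|k IH]; first by rewrite big_ord0 addr0 addn0.
rewrite big_ord_recr/= addrA (le_trans IH)// addrAC lerD2r addnS.
exact: hole_right.
Qed.

Lemma hole_left_sum a b k x :
  hole (a + k) b x <= hole a b x + \sum_(j < k) wt (a + j).
Proof.
elim: k => [|k IH]; first by rewrite big_ord0 addr0 addn0.
rewrite big_ord_recr/= addrA addnS (le_trans (hole_left _ _ _))// lerD2r.
exact: IH.
Qed.

End holes.

(** * A pointwise entropy inequality *)

Section entropy.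
Context {R : realType}.

(** The right-hand side has derivative [(r - 1)^3 / (r^2 (r + 2)^2)], hence its minimum is at
    [r = 1]. At [r = v / u] this gives the lower bound [3/2 (v - u)^2 / (v + 2 u)] on the entropy
    term of [pinsker_pointwise]. *)
Lemma ln_ge_rational (r : R) : 0 < r ->
  5 / 2 <= ln r + (1 / 4 * r^-1 + 27 / 4 * (r + 2)^-1).
Proof.
pose f (r : R) : R := ln r + (1 / 4 * r^-1 + 27 / 4 * (r + 2)^-1).
pose df (r : R) : R := (r - 1) ^+ 3 / (r ^+ 2 * (r + 2) ^+ 2).
move=> r0; change (5 / 2 <= f r).
have fd (x : R) : 0 < x -> is_derive x 1 f (df x).
  move=> x0; have x2 : x + 2 != 0 by rewrite gt_eqF//; lra.
  have xn0 : x != 0 by rewrite gt_eqF.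
  have h1 := is_derive1_ln x0.
  have h2 := @is_deriveV R id x 1 1 xn0 (is_derive_id _ _).
  have h2' : is_derive x 1 (fun y : R => y + 2) 1.
    have := is_deriveD (is_derive_id x 1) (is_derive_cst (2 : R) x 1).
    by move=> h; apply: is_derive_eq h _; rewrite addr0.
  have h3 := @is_deriveV R (fun y => y + 2) x 1 1 x2 h2'.
  have h4 := is_deriveD h1 (is_deriveD (is_deriveZ (1 / 4) h2)
    (is_deriveZ (27 / 4) h3)).
  apply: is_derive_eq h4 _.
  rewrite /df /GRing.scale/=; field.
  by rewrite x2.
have fc (x : R) : 0 < x -> {for x, continuous f}.
  move=> x0; apply/differentiable_continuous/derivable1_diffP.
  by have [] := fd _ x0.
have f1 : f 1 = 5 / 2 by rewrite /f ln1; field.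
have sub (a b : R) : 0 < a -> {within `[a, b], continuous f}.
  move=> a0; apply: continuous_in_subspaceT => x; rewrite inE/= in_itv/= => /andP[ax _].
  by apply: fc; lra.
have dfE (c : R) : 0 < c -> df c = (c - 1) * ((c - 1) ^+ 2 / (c ^+ 2 * (c + 2) ^+ 2)).
  by move=> c0; rewrite /df exprSr mulrA [_ * (c - 1)]mulrC.
have q0 (c : R) : 0 <= (c - 1) ^+ 2 / (c ^+ 2 * (c + 2) ^+ 2).
  by apply: divr_ge0; [|apply: mulr_ge0]; exact: sqr_ge0.
have [r1|r1|->] := ltgtP r 1; last by rewrite f1.
- have [|c /[!in_itv]/= /andP[rc c1] e] := @MVT R f df r 1 r1 _ (sub _ _ r0).
    by move=> x; rewrite in_itv/= => /andP[rx _]; apply: fd; lra.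
  have c0 : 0 < c by lra.
  move: e (q0 c); rewrite dfE// f1; set q := (_ ^+ 2 / _) => e qc; clearbody q.
  have : 0 <= (1 - c) * q * (1 - r) by rewrite !mulr_ge0//; lra.
  by lra.
- have [|c /[!in_itv]/= /andP[rc c1] e] := @MVT R f df 1 r r1 _ (sub _ _ ltr01).
    by move=> x; rewrite in_itv/= => /andP[rx _]; apply: fd; lra.
  have c0 : 0 < c by lra.
  move: e (q0 c); rewrite dfE// f1; set q := (_ ^+ 2 / _) => e qc; clearbody q.
  have : 0 <= (c - 1) * q * (r - 1) by rewrite !mulr_ge0//; lra.
  by lra.
Qed.

(* Pointwise form of Pinsker's inequality: summing and optimizing over [t]
   bounds the [L^1] distance of two densities [u] and [v] by the square root of
   their relative entropy. *)
Lemma pinsker_pointwise (t u v : R) : 0 < t -> 0 <= u -> 0 <= v ->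
  (u = 0 -> v = 0) ->
  `|v - u| <= t / 2 * (v + 2 * u) + (v * ln v - v * ln u - v + u) / (3 * t).
Proof.
move=> t0 u0 v0 uv.
have [u_eq0|un0] := eqVneq u 0.
  by rewrite u_eq0 (uv u_eq0) !mul0r !mulr0 !subr0 !addr0 normr0 mulr0 mul0r addr0.
have {u0}u0 : 0 < u by rewrite lt_neqAle eq_sym un0.
have ent : 3 / 2 * (v - u) ^+ 2 / (v + 2 * u) <= v * ln v - v * ln u - v + u.
  have [->|vn0] := eqVneq v 0.
    rewrite !mul0r !subr0 !add0r sqrrN ler_pdivrMr; last by lra.
    by have := sqr_ge0 u; lra.
  have {v0}v0 : 0 < v by rewrite lt_neqAle eq_sym vn0.
  have := @ln_ge_rational (v / u) ltac:(by rewrite divr_gt0).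
  rewrite ln_div ?posrE// => /(ler_wpM2l (ltW v0)) h.
  rewrite -subr_ge0; move: h; rewrite -subr_ge0; congr (0 <= _).
  by field; rewrite !gt_eqF//; lra.
have s0 : 0 < v + 2 * u by lra.
(* The arithmetic-geometric mean inequality with parameter [t]; the difference of the two sides is a
   square over a positive number. *)
apply: (@le_trans _ _ (t / 2 * (v + 2 * u) + 3 / 2 * (v - u) ^+ 2 / (v + 2 * u) / (3 * t))).
  have -> : t / 2 * (v + 2 * u) + 3 / 2 * (v - u) ^+ 2 / (v + 2 * u) / (3 * t) =
    `|v - u| + (t * (v + 2 * u) - `|v - u|) ^+ 2 / (2 * t * (v + 2 * u)).
    rewrite -[(v - u) ^+ 2]real_normK ?num_real//.
    by field; rewrite !gt_eqF.
  by rewrite lerDl divr_ge0 ?sqr_ge0// !mulr_ge0// ltW.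
by rewrite lerD2l ler_wpM2r// invr_ge0 ltW// mulr_gt0.
Qed.

End entropy.

(** * The transport inequality *)

Section transport.
Context {R : realType} {K : finType} {n m : nat}.
Local Notation T := {ffun 'I_n -> K}.
Implicit Types (x y z : T) (f h : T -> R).
Hypotheses (m_gt0 : (0 < m)%N) (n_ge : (2 * m <= n)%N).
Variable P : T -> R.
Hypothesis P_ge0 : forall x, 0 <= P x.
Hypothesis P_sum1 : \sum_x P x = 1.
Variables (G : T -> R) (w : R).
Hypothesis w_ge0 : 0 <= w.
Hypothesis lipG : forall x y i,
  (forall j, j != i -> x j = y j) -> G x <= G y + w.
Variables (D : T -> R) (B beta : R).
Hypothesis D_ge0 : forall x, 0 <= D x.
Hypothesis D_le : forall x, D x <= B.
Hypothesis D_mean : expect P D = 1.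
Hypothesis B_gt1 : 1 < B.

(** A window starting at [c] only pays for positions [c + s] with [s < 3 m]. With this padding, when
    [c] runs through the [n + S] starting points, each offset [s] meets every coordinate exactly
    once. *)
Local Notation S := (3 * m)%N.
Local Notation g := m.-1.
Local Notation "''E' f" := (expect P f) (at level 10, f at level 8).
Local Notation hole := (inf_hole S G).
Local Notation wt := (@wt R n S w).

(** The neighbours of a hole of [m - 1] coordinates are [m] apart in time, so [beta] stands for the
    coefficient at lag [m]. Holes with no coordinate on one of their sides are left to
    [err_triv]. *)
Hypothesis mixing : forall k, (S < k)%N -> (k + g < n + S)%N ->
  forall A : {set T}, depends S (outside k (k + g)) (fun x => (x \in A)%:R : R) ->
  \sum_(x in A) P x <= indep_expect S P k (fun=> 1) (fun x => (x \in A)%:R) + beta.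

(** The martingale [N_k]; it is 1 up to [k = S] and almost surely [D] from [k = n + S] on. *)
Definition dens k : T -> R := cexp S P k D.

Lemma dens_depends k : depends S (fun p => p < k)%N (dens k).
Proof. exact: cexp_depends. Qed.

Lemma dens_ge0 k x : 0 <= dens k x. Proof. exact: cexp_ge0. Qed.

Lemma dens_le k x : dens k x <= B.
Proof. by apply: cexp_le => //; rewrite (le_trans ler01)// ltW. Qed.

Lemma dens_triv k x : (k <= S)%N -> dens k x = 1.
Proof. by move=> kS; rewrite /dens cexp_trivial. Qed.

Lemma expect_dens k h : depends S (fun p => p < k)%N h ->
  'E (fun x => dens k x * h x) = 'E (fun x => D x * h x).
Proof. exact: expect_cexp. Qed.

Lemma dens_mean k : 'E (dens k) = 1.
Proof.
rewrite -D_mean; transitivity ('E (fun x => dens k x * 1)).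
  by apply: eq_bigr => x _; rewrite mulr1.
by rewrite expect_dens//; apply: eq_bigr => x _; rewrite mulr1.
Qed.

(** If the mean of [D] over the class of [x] at [a] is 0, then [D] vanishes almost surely on it,
    hence on the smaller class at [b]. This is the absolute continuity asked for by
    [pinsker_pointwise]. *)
Lemma dens_eq0 a b x : (a <= b)%N -> 0 < P x -> dens a x = 0 -> dens b x = 0.
Proof.
move=> ab Px; rewrite /dens /cexp => /eqP.
set Z := \sum_(y | _) P y.
have Z0 : 0 < Z.
  by rewrite /Z (bigD1 x) ?agree_refl//= ltr_wpDr// sumr_ge0.
rewrite mulf_eq0 invr_eq0 (gt_eqF Z0) orbF psumr_eq0; last first.
  by move=> y _; rewrite mulr_ge0.
move=> /allP h; rewrite big1 ?mul0r// => y xy; apply/eqP.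
have /implyP := h y (mem_index_enum y); apply.
by apply: agree_sub xy => p pa; exact: leq_trans ab.
Qed.

Definition ent k := 'E (fun x => dens k x * ln (dens k x)).
Definition tv a b := 'E (fun x => Num.max (dens b x - dens a x) 0).

Lemma ent_ge0 k : 0 <= ent k.
Proof.
have -> : 0 = 'E (fun x => dens k x - 1).
  by rewrite expectB dens_mean expect_cst// subrr.
apply: ler_expect => // x _.
have := dens_ge0 k x; rewrite le_eqVlt => /predU1P[<-|d0].
  by rewrite mul0r; lra.
have := @le_ln1Dx R ((dens k x)^-1 - 1).
rewrite addrCA subrr addr0 lnV ?posrE// => /(_ _).
have i0 : 0 < (dens k x)^-1 by rewrite invr_gt0.
move=> /(_ ltac:(lra)); rewrite -subr_ge0 => /(mulr_ge0 (ltW d0)).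
rewrite !mulrBr mulfV ?gt_eqF//; lra.
Qed.

Lemma ent_le k : ent k <= ln B.
Proof.
have -> : ln B = 'E (fun x => ln B * dens k x).
  by rewrite expectZ dens_mean mulr1.
apply: ler_expect => // x _; rewrite mulrC.
have := dens_ge0 k x; rewrite le_eqVlt => /predU1P[<-|d0].
  by rewrite !mulr0.
by rewrite ler_wpM2r ?(ltW d0)// ler_ln ?posrE ?dens_le// (lt_trans ltr01).
Qed.

(** Pinsker's inequality before optimization over [t]. Since [ln (dens a)] is determined by the
    coordinates before [a], the martingale property makes the entropy of [dens b] relative to
    [dens a] equal to [ent b - ent a]. *)
Lemma tv_le a b t : (a <= b)%N -> 0 < t ->
  tv a b <= 3 / 4 * t + (ent b - ent a) / (6 * t).
Proof.
move=> ab t0.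
have cross : 'E (fun x => dens b x * ln (dens a x)) = ent a.
  have h k : (k <= b)%N -> depends S (fun p => p < b)%N (fun x => ln (dens k x)).
    move=> kb; apply: (@depends_sub _ _ _ _ (fun p => p < k)%N) => [p|x y xy].
      by move/leq_trans; exact.
    by rewrite (dens_depends _ _ _ xy).
  rewrite expect_dens; last exact: h.
  by rewrite /ent expect_dens// => x y xy; rewrite (dens_depends _ _ _ xy).
have : 'E (fun x => `|dens b x - dens a x|) <=
    'E (fun x => t / 2 * (dens b x + 2 * dens a x) +
       (dens b x * ln (dens b x) - dens b x * ln (dens a x)
          - dens b x + dens a x) / (3 * t)).
  apply: ler_expect => // x Px; apply: pinsker_pointwise => //.
  - exact: dens_ge0.
  - exact: dens_ge0.
  - exact: dens_eq0.
have -> : 'E (fun x => `|dens b x - dens a x|) = 2 * tv a b.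
  transitivity ('E (fun x => 2 * Num.max (dens b x - dens a x) 0
      - (dens b x - dens a x))).
    apply: eq_expect => // x _; have [d|d] := leP (dens b x - dens a x) 0.
      by rewrite ler0_norm//; lra.
    by rewrite gtr0_norm//; lra.
  by rewrite !expectB expectZ !dens_mean subrr subr0.
have EZr c f : 'E (fun x => f x * c) = 'E f * c.
  by rewrite /expect mulr_suml; apply: eq_bigr => x _; rewrite mulrA.
rewrite expectD EZr expectZ expectD expectZ expectD !expectB cross -/(ent b) !dens_mean.
set e := (_ - _ - 1 + 1).
have -> : e = ent b - ent a by rewrite /e; lra.
have -> : (ent b - ent a) / (6 * t) = (3 * t)^-1 * (ent b - ent a) / 2.
  by field; rewrite gt_eqF.
lra.
Qed.

(** Increments over [x] steps split into [x] families of unit increments, and each family telescopes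
    to at most [ln B]. *)
Lemma sum_ent (q x : nat) : \sum_(i < n) (ent (q + i + x) - ent (q + i)) <= x%:R * ln B.
Proof.
elim: x => [|x IH].
  by rewrite big1 ?mul0r// => i _; rewrite addn0 subrr.
rewrite -natr1 mulrDl mul1r.
have -> : \sum_(i < n) (ent (q + i + x.+1) - ent (q + i)) =
    \sum_(i < n) (ent (q + i + x) - ent (q + i)) +
    \sum_(i < n) (ent (q + x + i.+1) - ent (q + x + i)).
  rewrite -big_split/=; apply: eq_bigr => i _.
  have -> : (q + x + i.+1 = q + i + x.+1)%N by nat_lia.
  by rewrite [RHS]addrC [(q + x + i)%N]addnAC addrA subrK.
rewrite lerD//.
rewrite -(big_mkord xpredT (fun i => ent (q + x + i.+1) - ent (q + x + i))).
rewrite (telescope_sumr (fun i => ent (q + x + i)))// addn0.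
by rewrite lerBlDr (le_trans (ent_le _))// lerDl ent_ge0.
Qed.

Lemma sum_tv (q x : nat) : \sum_(i < n) tv (q + i) (q + i + x) <=
  Num.sqrt (n%:R * x%:R * ln B / 2).
Proof.
have [->|x0] := eqVneq x 0%N.
  rewrite big1 ?sqrtr_ge0// => i _; rewrite addn0 /tv.
  by rewrite /expect big1// => y _; rewrite subrr maxxx mulr0.
have n0 : 0 < n%:R :> R by rewrite ltr0n; nat_lia.
have {}x0 : 0 < x%:R :> R by rewrite ltr0n lt0n.
have L0 : 0 < ln B by rewrite ln_gt0.
(* The minimizer of [3/4 n t + x ln B / (6 t)]. *)
pose t := Num.sqrt (n%:R * x%:R * ln B / 2) / n%:R * (2 / 3).
have s0 : 0 < Num.sqrt (n%:R * x%:R * ln B / 2).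
  by rewrite sqrtr_gt0 !mulr_gt0// invr_gt0.
have t0 : 0 < t by rewrite !mulr_gt0 ?invr_gt0//; lra.
apply: (@le_trans _ _ (\sum_(i < n) (3 / 4 * t +
    (ent (q + i + x) - ent (q + i)) / (6 * t)))).
  by apply: ler_sum => i _; apply: tv_le => //; rewrite leq_addr.
rewrite big_split/= sumr_const card_ord -mulr_suml.
apply: (@le_trans _ _ (3 / 4 * t *+ n + x%:R * ln B / (6 * t))).
  by rewrite lerD2l ler_wpM2r ?sum_ent// invr_ge0 mulr_ge0// ltW.
rewrite -mulr_natr le_eqVlt; apply/orP; left; apply/eqP.
have s2 : x%:R * ln B = 2 / n%:R * Num.sqrt (n%:R * x%:R * ln B / 2) ^+ 2.
  rewrite sqr_sqrtr; first by field; rewrite gt_eqF.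
  by rewrite ltW// !mulr_gt0// invr_gt0.
rewrite s2 /t; field.
by rewrite !gt_eqF.
Qed.

Lemma wt_in c s : (s <= S)%N -> (S - s <= c < S - s + n)%N -> wt (c + s) = w.
Proof. by move=> sS cs; rewrite /wt; case: ifP => //; nat_lia. Qed.

Lemma wt_out c s : (s <= S)%N -> ~~ (S - s <= c < S - s + n)%N -> wt (c + s) = 0.
Proof. by move=> sS cs; rewrite /wt; case: ifP => //; nat_lia. Qed.

(** Only the [n] values of [c] for which [c + s] carries a coordinate contribute. *)
Lemma sum_wt_tv (s a x : nat) : (s <= S)%N ->
  \sum_(c < n + S) wt (c + s) * tv (c + a) (c + a + x) <=
  w * Num.sqrt (n%:R * x%:R * ln B / 2).
Proof.
move=> sS.
rewrite -(big_mkord xpredT (fun c => wt (c + s) * tv (c + a) (c + a + x))).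
rewrite (@big_cat_nat _ _ _ (S - s))//=; last by nat_lia.
rewrite (@big_cat_nat _ _ _ (S - s + n) (S - s))//=; [|by nat_lia|by nat_lia].
rewrite big_nat_cond big1 ?add0r; last first.
  by move=> c /andP[c1 _]; rewrite wt_out ?mul0r//; nat_lia.
rewrite [X in _ + X]big_nat_cond [X in _ + X]big1 ?addr0; last first.
  by move=> c /andP[c1 _]; rewrite wt_out ?mul0r//; nat_lia.
rewrite -{1}[(S - s)%N]add0n. rewrite big_addn addKn big_mkord.
apply: le_trans (ler_wpM2l w_ge0 (@sum_tv (S - s + a) x)); rewrite mulr_sumr.
rewrite le_eqVlt; apply/orP; left; apply/eqP; apply: eq_bigr => i _.
by rewrite wt_in//; [congr (w * tv _ _); nat_lia|have := ltn_ord i; nat_lia].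
Qed.

Definition decoupling_error k f :=
  'E (fun x => dens k x * f x) - indep_expect S P k (dens k) f.
Local Notation err := decoupling_error.

Lemma errB k f1 f2 : err k (fun x => f1 x - f2 x) = err k f1 - err k f2.
Proof.
rewrite /err indep_expectB.
have -> : 'E (fun x => dens k x * (f1 x - f2 x)) =
    'E (fun x => dens k x * f1 x) - 'E (fun x => dens k x * f2 x).
  by rewrite -expectB; apply: eq_bigr => x _; rewrite mulrBr.
ring.
Qed.

Lemma eq_err k f1 f2 : f1 =1 f2 -> err k f1 = err k f2.
Proof.
move=> e; rewrite /err (eq_indep_expect _ _ _ _ _ _ e); congr (_ - _).
by apply: eq_bigr => x _; rewrite e.
Qed.

Lemma err0 k : err k (fun=> 0) = 0.
Proof.
rewrite (@eq_err k _ (fun=> 0 - 0)) ?errB ?subrr// => x; exact: subrr.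
Qed.

Lemma errD k f1 f2 : err k (fun x => f1 x + f2 x) = err k f1 + err k f2.
Proof.
rewrite (@eq_err k _ (fun x => f1 x - (0 - f2 x))).
  by rewrite errB errB err0 sub0r opprK.
by move=> x; rewrite sub0r opprK.
Qed.

Lemma err_sum k (I : Type) (r : seq I) (F : I -> T -> R) :
  err k (fun x => \sum_(i <- r) F i x) = \sum_(i <- r) err k (F i).
Proof.
elim: r => [|i r IH].
  rewrite big_nil -[RHS](err0 k); apply: eq_err => x; exact: big_nil.
by rewrite big_cons -IH -errD; apply: eq_err => x; exact: big_cons.
Qed.

(** Mixing is applied to [dens k * (f - lo)], which has values in [[0, B (hi - lo)]]. Subtracting
    [lo] does not affect the error, since [dens k] has mean 1 under both laws. *)
Lemma err_le k f lo hi : (S < k)%N -> (k + g < n + S)%N ->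
  depends S (outside k (k + g)) f -> (forall x, lo <= f x <= hi) ->
  err k f <= B * (hi - lo) * beta.
Proof.
move=> Sk kn fd fb.
pose h x := dens k x * (f x - lo).
have hd : depends S (outside k (k + g)) h.
  move=> x y xy; rewrite /h (fd _ _ xy); congr (_ * _).
  by apply: dens_depends; apply: agree_sub xy => p; rewrite /outside; nat_lia.
have hb x : 0 <= h x <= B * (hi - lo).
  have /andP[lof fhi] := fb x; have d0 := dens_ge0 k x.
  by rewrite mulr_ge0 ?subr_ge0//= ler_pM ?subr_ge0// ?dens_le// lerD2r.
have := mixing_expect _ _ P_sum1 _ _ _ (mixing _ Sk kn) _ _ hd hb.
rewrite (@indep_expect_depends _ _ _ S P k (dens k) (fun x => f x - lo)); last first.
  exact: dens_depends.
rewrite (indep_expectB _ _ _ _ f (fun=> lo)) indep_expect_cst// dens_mean.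
have -> : 'E h = 'E (fun x => dens k x * f x) - lo.
  rewrite -[lo in RHS]mulr1 -(dens_mean k) -expectZ -expectB.
  by apply: eq_bigr => x _; rewrite /h mulrBr [lo * _]mulrC.
rewrite /err; lra.
Qed.

(** With no coordinate before [k], or none after the hole, there is nothing to decouple. *)
Lemma err_triv k f : (k <= S)%N || (n + S <= k + g)%N ->
  depends S (outside k (k + g)) f -> err k f = 0.
Proof.
move=> /orP[kS|nk] fd; apply/eqP; rewrite subr_eq0; apply/eqP.
  transitivity ('E f).
    by apply: eq_bigr => x _; rewrite dens_triv// mul1r.
  rewrite /indep_expect exchange_big; apply: eq_bigr => y _.
  rewrite -[f y in LHS]mul1r -[in LHS]P_sum1 mulr_suml mulr_sumr.
  apply: eq_bigr => x _; rewrite dens_triv//.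
  have -> : splice S k x y = y.
    apply/ffunP => i; rewrite ffunE ifF//; apply/negbTE.
    by rewrite -leqNgt (leq_trans kS)// leq_addl.
  ring.
rewrite /indep_expect; apply: eq_bigr => x _.
rewrite -[LHS]mul1r -[in LHS]P_sum1 mulr_suml; apply: eq_bigr => y _.
have -> : f (splice S k x y) = f x.
  apply: fd; apply/agreeP => i; rewrite /outside => oi.
  by rewrite ffunE ifT//; have := ltn_ord i; nat_lia.
ring.
Qed.

Definition gap_expect a b := indep_expect S P a D (hole a b).

(** After decoupling, the place [k] of the cut inside [[a, b]] is immaterial, as [hole a b] ignores
    the coordinates there; [dens k] can then be replaced by [D], because it multiplies a function of
    the coordinates before [a]. Having a main term free of [k] is what makes the sums telescope. *)
Lemma expect_hole k a b : (a <= k)%N -> (k <= b)%N ->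
  'E (fun x => dens k x * hole a b x) = err k (hole a b) + gap_expect a b.
Proof.
move=> ak kb; rewrite /err.
suff -> : indep_expect S P k (dens k) (hole a b) = gap_expect a b by lra.
have inner f l : indep_expect S P l f (hole a b) =
    'E (fun x => f x * \sum_y P y * hole a b (splice S l x y)).
  rewrite /indep_expect; apply: eq_bigr => x _; rewrite !mulr_sumr.
  by apply: eq_bigr => y _; ring.
rewrite /gap_expect !inner.
have e x y : hole a b (splice S k x y) = hole a b (splice S a x y).
  apply: hole_depends; apply/agreeP => i; rewrite /outside !ffunE => oi.
  by case: ltnP => ?; case: ltnP => ? //; nat_lia.
rewrite -(expect_dens k (fun x => \sum_y P y * hole a b (splice S a x y))).
  by apply: eq_bigr => x _; congr (_ * (_ * _)); apply: eq_bigr => y _; rewrite e.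
move=> x x' xx; apply: eq_bigr => y _; congr (_ * hole a b _).
apply/ffunP => i; rewrite !ffunE; case: ifP => // ia.
by move/agreeP : xx; apply; exact: leq_trans ak.
Qed.

Lemma expect_diff_le a b f q : (forall x, 0 <= f x <= q) ->
  'E (fun x => (dens b x - dens a x) * f x) <= q * tv a b.
Proof.
move=> fq; rewrite -expectZ; apply: ler_expect => // x _.
have /andP[f0 fq'] := fq x; have [d|d] := leP (dens b x - dens a x) 0.
  by rewrite mulr0 mulr_le0_ge0.
by rewrite mulrC ler_wpM2r// ltW.
Qed.

(* The hole of length [m - 1] around [c + m] is first opened ([h1]), then widened
   to the right ([h2]) and to the left ([h3]). *)
Lemma center_step c :
  'E (fun x => dens (c + 2 * m) x * G x) - 'E (fun x => dens c x * G x) <=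
  \sum_(i < g) wt (c + (m + i)) * tv c (c + 2 * m)
  + \sum_(j < m) wt (c + (m + g + j)) * tv (c + (m + j)) (c + 2 * m)
  + \sum_(j < m) wt (c + j) * tv c (c + j.+1)
  + (err (c + 2 * m) (hole (c + m) (c + 2 * m + g))
     - err c (hole c (c + m + g))
     + \sum_(j < m) err (c + (m + j)) (fun x =>
         hole (c + m) (c + (m + j) + g) x - hole (c + m) (c + (m + j) + g).+1 x)
     - \sum_(j < m) err (c + j.+1) (fun x =>
         hole (c + j.+1) (c + m + g) x - hole (c + j) (c + m + g) x)).
Proof.
pose a := (c + m)%N; pose b := (c + m + g)%N.
pose E k f := 'E (fun x => dens k x * f x).
have EB k f1 f2 : E k (fun x => f1 x - f2 x) = E k f1 - E k f2.
  by rewrite /E -expectB; apply: eq_bigr => x _; rewrite mulrBr.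
have Edens k l f : E k f - E l f = 'E (fun x => (dens k x - dens l x) * f x).
  by rewrite /E -expectB; apply: eq_bigr => x _; rewrite mulrBl.
have Eh k u v : (u <= k)%N -> (k <= v)%N ->
    E k (hole u v) = err k (hole u v) + gap_expect u v.
  exact: expect_hole.
have tele (u : nat -> R) k : \sum_(j < k) (u j - u j.+1) = u 0%N - u k.
  elim: k => [|k IH]; first by rewrite big_ord0 subrr.
  by rewrite big_ord_recr/= IH; ring.
(* Opening the hole: [G] exceeds its infimum over [g] coordinates by at most the sum of their
   weights. *)
have h1 : E (c + 2 * m)%N (fun x => G x - hole a b x) -
    E c (fun x => G x - hole a b x) <=
    \sum_(i < g) wt (c + (m + i)) * tv c (c + 2 * m).
  rewrite Edens -mulr_suml; apply: expect_diff_le => x.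
  rewrite subr_ge0 -(@hole_id _ _ _ S G a a x)//.
  rewrite hole_anti//=; last by rewrite /a /b; nat_lia.
  rewrite lerBlDl; apply: le_trans (hole_right_sum _ _ _ lipG a a g x) _.
  rewrite lerD2l le_eqVlt; apply/orP; left; apply/eqP; apply: eq_bigr => i _.
  by rewrite /a addnA.
(* When position [b + j] is absorbed, the density is taken back to time [c + m + j]: the [m - 1]
   coordinates after that time lie in the hole, which is the form required by mixing. *)
have h2 : E (c + 2 * m)%N (hole a b) <=
    \sum_(j < m) wt (c + (m + g + j)) * tv (c + (m + j)) (c + 2 * m)
    + \sum_(j < m) E (c + (m + j))%N
        (fun x => hole a (b + j) x - hole a (b + j).+1 x)
    + E (c + 2 * m)%N (hole a (b + m)).
  rewrite -lerBlDr.
  have -> : E (c + 2 * m)%N (hole a b) - E (c + 2 * m)%N (hole a (b + m)) =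
      \sum_(j < m) E (c + 2 * m)%N (fun x => hole a (b + j) x - hole a (b + j).+1 x).
    under eq_bigr do rewrite EB -addnS.
    by rewrite (tele (fun j => E (c + 2 * m)%N (hole a (b + j)))) addn0.
  rewrite -big_split/=; apply: ler_sum => j _.
  rewrite -lerBlDr Edens; apply: expect_diff_le => x.
  rewrite subr_ge0 hole_anti//= lerBlDl.
  have -> : (c + (m + g + j) = b + j)%N by rewrite /b; nat_lia.
  exact: hole_right.
(* When position [c + j] is absorbed, the density is advanced from time [c] to time [c + j + 1], the
   left end of the hole before absorption. *)
have h3 : - E c (hole a b) <=
    \sum_(j < m) wt (c + j) * tv c (c + j.+1)
    - \sum_(j < m) E (c + j.+1)%N (fun x => hole (c + j.+1) b x - hole (c + j) b x)
    - E c (hole c b).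
  rewrite -subr_ge0 opprK.
  have -> : \sum_(j < m) wt (c + j) * tv c (c + j.+1)
    - \sum_(j < m) E (c + j.+1)%N (fun x => hole (c + j.+1) b x - hole (c + j) b x)
    - E c (hole c b) + E c (hole a b) =
    \sum_(j < m) wt (c + j) * tv c (c + j.+1)
    - \sum_(j < m) E (c + j.+1)%N (fun x => hole (c + j.+1) b x - hole (c + j) b x)
    + \sum_(j < m) E c (fun x => hole (c + j.+1) b x - hole (c + j) b x).
    rewrite -addrA; congr (_ + _).
    have := tele (fun j => - E c (hole (c + j) b)) m.
    rewrite addn0 -/a => e; rewrite addrC -[E c (hole a b)]opprK -opprD addrC.
    transitivity (- E c (hole c b) - - E c (hole a b)); first by ring.
    by rewrite -e; apply: eq_bigr => j _; rewrite EB; ring.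
  rewrite -sumrB -big_split/=; apply: sumr_ge0 => j _.
  rewrite -addrA [X in _ + X]addrC -opprB subr_ge0 Edens; apply: expect_diff_le => x.
  rewrite subr_ge0 hole_anti//=; last by rewrite leq_add2l.
  by rewrite lerBlDl addnS; exact: hole_left.
(* In [e2] to [e5] the values of [gap_expect] telescope; their total over the three inequalities is
   0, so only decoupling errors remain. *)
have e2 : \sum_(j < m) E (c + (m + j))%N
        (fun x => hole a (b + j) x - hole a (b + j).+1 x) =
    \sum_(j < m) err (c + (m + j)) (fun x =>
         hole (c + m) (c + (m + j) + g) x - hole (c + m) (c + (m + j) + g).+1 x)
    + (gap_expect a b - gap_expect a (b + m)).
  have := tele (fun j => gap_expect a (b + j)) m; rewrite addn0 => <-.
  rewrite -big_split/=; apply: eq_bigr => j _.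
  rewrite EB !Eh ?errB; try by rewrite /a /b; nat_lia.
  have -> : (c + (m + j) + g = b + j)%N by rewrite /b; nat_lia.
  by rewrite -/a addnS; ring.
have e3 : \sum_(j < m) E (c + j.+1)%N (fun x => hole (c + j.+1) b x - hole (c + j) b x) =
     \sum_(j < m) err (c + j.+1) (fun x =>
         hole (c + j.+1) (c + m + g) x - hole (c + j) (c + m + g) x)
     - (gap_expect c b - gap_expect a b).
  have := tele (fun j => gap_expect (c + j) b) m; rewrite addn0 -/a => <-.
  rewrite -sumrB; apply: eq_bigr => j _; have := ltn_ord j => jm.
  rewrite EB !Eh ?errB; try by rewrite /a /b; nat_lia.
  by rewrite -/b; ring.
have e4 : E (c + 2 * m)%N (hole a (b + m)) =
    err (c + 2 * m) (hole (c + m) (c + 2 * m + g)) + gap_expect a (b + m).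
  rewrite Eh; try by rewrite /a /b; nat_lia.
  by have -> : (c + 2 * m + g = b + m)%N by rewrite /b; nat_lia.
have e5 : E c (hole c b) = err c (hole c (c + m + g)) + gap_expect c b.
  by rewrite Eh// /b; nat_lia.
move: h1 h2 h3; rewrite !EB e2 e4 e3 e5 -!/(E _ G) => h1 h2 h3.
clear EB Edens Eh e2 e3 e4 e5; lra.
Qed.

(** Indexes the decoupling errors by the place of the cut instead of the start of the window; the
    terms lost at both ends vanish by [err_triv]. *)
Lemma sum_shift (F : nat -> R) s : (s <= S)%N ->
  (forall k, (k <= S)%N || (n + S <= k + g)%N -> F k = 0) ->
  \sum_(c < n + S) F (c + s)%N = \sum_(k < n + S) F k.
Proof.
move=> sS F0.
rewrite -(big_mkord xpredT (fun c => F (c + s)%N)) -(big_mkord xpredT F).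
rewrite [in RHS](@big_cat_nat _ _ _ s)//=; last by nat_lia.
rewrite [X in _ = X + _]big_nat_cond [X in _ = X + _]big1 ?add0r; last first.
  by move=> k /andP[k1 _]; apply: F0; nat_lia.
have -> : \sum_(0 <= c < n + S) F (c + s)%N = \sum_(s <= k < n + S + s) F k.
  by rewrite -{2}[s]add0n big_addn addnK.
rewrite (@big_cat_nat _ _ _ (n + S))//=; [|nat_lia|nat_lia].
rewrite [X in _ + X]big_nat_cond [X in _ + X]big1 ?addr0// => k /andP[k1 _].
by apply: F0; nat_lia.
Qed.

Lemma sum_ind_lt (N M : nat) :
  \sum_(i < N) (if (i < M)%N then w else 0) = w * (minn N M)%:R.
Proof.
elim: N => [|N IH]; first by rewrite big_ord0 min0n mulr0.
rewrite big_ord_recr/= IH; case: ltnP => h.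
  have -> : minn N.+1 M = N.+1 by nat_lia.
  by rewrite -[X in _ = _ * X]natr1 mulrDr mulr1.
by rewrite addr0; congr (_ * _%:R); nat_lia.
Qed.

Lemma sum_ind_ge (N M : nat) :
  \sum_(i < N) (if (M <= i)%N then w else 0) = w * (N - M)%:R.
Proof.
elim: N => [|N IH]; first by rewrite big_ord0 sub0n mulr0.
rewrite big_ord_recr/= IH; case: leqP => h.
  by rewrite subSn// -[X in _ = _ * X]natr1 mulrDr mulr1.
by rewrite addr0; congr (_ * _%:R); nat_lia.
Qed.

(** Bound on the oscillation of the sum of all decoupling errors at position [k], the function [H k]
    of [error_le]. *)
Definition osc k :=
  2 * m%:R * w + \sum_(u < m) wt (k + g + u) + \sum_(u < m) wt (k - m + u).

(** Away from the ends [osc] is [4 m w]. The weights beyond the left end and those beyond the right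
    end each remove [w m (m - 1) / 2] from the sum. *)
Lemma sum_osc :
  \sum_(i < n - m) osc (S + i.+1) = w * (4 * m%:R * (n - m)%:R - m%:R * (m%:R - 1)).
Proof.
rewrite /osc !big_split/= sumr_const card_ord exchange_big/=.
rewrite [X in _ + X]exchange_big/= -addrA -big_split/=.
have -> : \sum_(u < m) (\sum_(i < n - m) wt (S + i.+1 + g + u)
      + \sum_(i < n - m) wt (S + i.+1 - m + u)) =
    \sum_(u < m) w * (2 * (n - m)%:R - (m%:R - 1)).
  apply: eq_bigr => u _; have um := ltn_ord u.
  transitivity (\sum_(i < n - m) (if (i < n - m - u)%N then w else 0) +
      \sum_(i < n - m) (if (m - u.+1 <= i)%N then w else 0)).
    congr (_ + _); apply: eq_bigr => i _; have := ltn_ord i => im;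
    by rewrite /wt; congr (if _ then _ else _); apply/idP/idP; nat_lia.
  rewrite sum_ind_lt sum_ind_ge (minn_idPr _); last by nat_lia.
  rewrite -mulrDr; congr (_ * _).
  have e : (n - m - u + (n - m - (m - u.+1)) + m = 2 * (n - m) + 1)%N by nat_lia.
  have := congr1 (fun k => k%:R : R) e; rewrite /= !natrD.
  by set p := (n - m - u)%:R; set q := (n - m)%:R; lra.
rewrite sumr_const card_ord -[X in X + _]mulr_natr -[X in _ + X]mulr_natr; ring.
Qed.

(** Errors at the same position are added up before mixing is applied, so that [beta] is paid once
    per position, times the oscillation of the sum. *)
Lemma error_le : 0 <= beta ->
  \sum_(k < n + S)
    (err k (hole (k - m) (k + g)) - err k (hole k (k + m + g))
     + \sum_(j < m) err k (fun x => hole (k - j) (k + g) x - hole (k - j) (k + g).+1 x)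
     - \sum_(j < m) err k (fun x => hole k (k - j.+1 + m + g) x
                                   - hole k.-1 (k - j.+1 + m + g) x)) <=
  B * beta * (w * (4 * m%:R * (n - m)%:R - m%:R * (m%:R - 1))).
Proof.
move=> beta0.
pose H k x := hole (k - m) (k + g) x - hole k (k + m + g) x
     + \sum_(j < m) (hole (k - j) (k + g) x - hole (k - j) (k + g).+1 x)
     - \sum_(j < m) (hole k (k - j.+1 + m + g) x - hole k.-1 (k - j.+1 + m + g) x).
have HE k : err k (H k) = err k (hole (k - m) (k + g)) - err k (hole k (k + m + g))
     + \sum_(j < m) err k (fun x => hole (k - j) (k + g) x - hole (k - j) (k + g).+1 x)
     - \sum_(j < m) err k (fun x => hole k (k - j.+1 + m + g) x
                                   - hole k.-1 (k - j.+1 + m + g) x).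
  by rewrite /H errB errD errB !err_sum.
under eq_bigr do rewrite -HE.
have sub k a b : (a <= k)%N -> (k + g <= b)%N -> depends S (outside k (k + g)) (hole a b).
  move=> ak kb; apply: (@depends_sub _ _ _ _ (outside a b)); last exact: hole_depends.
  by move=> p; rewrite /outside; nat_lia.
have Hd k : depends S (outside k (k + g)) (H k).
  move=> x y xy; rewrite /H.
  rewrite !(sub k _ _ _ _ _ _ xy); try by nat_lia.
  congr (_ - _ + _ - _); apply: eq_bigr => j _; have jm := ltn_ord j;
    by rewrite !(sub k _ _ _ _ _ _ xy)//; nat_lia.
rewrite -(big_mkord xpredT (fun k => err k (H k))).
(* Only [n - m] positions have a coordinate before the cut and another one after the hole. *)
rewrite (@big_cat_nat _ _ _ S.+1)//=; last by nat_lia.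
rewrite big_nat_cond big1 ?add0r; last first.
  by move=> k /andP[k1 _]; apply: err_triv => //; nat_lia.
rewrite (@big_cat_nat _ _ _ (S.+1 + (n - m)))//=; [|nat_lia|nat_lia].
rewrite [X in _ + X]big_nat_cond [X in _ + X]big1 ?addr0; last first.
  by move=> k /andP[k1 _]; apply: err_triv => //; nat_lia.
rewrite -{1}[S.+1]add0n big_addn addKn big_mkord.
rewrite -sum_osc mulr_sumr; apply: ler_sum => i _.
have -> : (i + S.+1 = S + i.+1)%N by nat_lia.
set k := (S + i.+1)%N; have im := ltn_ord i.
pose hi := m%:R * w + \sum_(u < m) wt (k + g + u).
pose lo := - (m%:R * w + \sum_(u < m) wt (k - m + u)).
have -> : B * beta * osc k = B * (hi - lo) * beta by rewrite /osc /hi /lo; ring.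
apply: err_le => //; [by rewrite /k; nat_lia|by rewrite /k; nat_lia|move=> x].
have s1 : 0 <= \sum_(j < m) (hole (k - j) (k + g) x - hole (k - j) (k + g).+1 x) <=
    m%:R * w.
  rewrite sumr_ge0/=; last by move=> j _; rewrite subr_ge0 hole_anti.
  rewrite mulr_natl -[X in _ *+ X]card_ord -sumr_const; apply: ler_sum => j _.
  by rewrite lerBlDl (le_trans (hole_right _ _ _ lipG _ _ _))// lerD2l wt_le.
have s2 : 0 <= \sum_(j < m) (hole k (k - j.+1 + m + g) x
    - hole k.-1 (k - j.+1 + m + g) x) <= m%:R * w.
  rewrite sumr_ge0/=; last by move=> j _; rewrite subr_ge0 hole_anti// leq_pred.
  rewrite mulr_natl -[X in _ *+ X]card_ord -sumr_const; apply: ler_sum => j _.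
  rewrite lerBlDl (_ : hole k _ x = hole k.-1.+1 (k - j.+1 + m + g) x); last first.
    by rewrite (prednK (_ : 0 < k)%N)// /k addnS.
  by rewrite (le_trans (hole_left _ _ _ lipG _ _ _))// lerD2l wt_le.
have h1 : hole (k - m) (k + g) x <= hole k (k + m + g) x + \sum_(u < m) wt (k + g + u).
  apply: le_trans (hole_right_sum _ _ _ lipG _ _ m _) _; rewrite lerD2r.
  by apply: hole_anti; nat_lia.
have h2 : hole k (k + m + g) x <= hole (k - m) (k + g) x + \sum_(u < m) wt (k - m + u).
  have {1}-> : k = (k - m + m)%N by rewrite /k; nat_lia.
  apply: le_trans (hole_left_sum _ _ _ lipG _ _ _ _) _; rewrite lerD2r.
  by apply: hole_anti; nat_lia.
move: s1 s2 => /andP[s10 s11] /andP[s20 s21].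
by move: h1 h2 s10 s11 s20 s21; rewrite /H /hi /lo => *; apply/andP; split; lra.
Qed.

Lemma sum_shift_diff (a : nat -> R) N q :
  \sum_(c < N) (a (c + q)%N - a c) = \sum_(i < q) (a (N + i)%N - a i).
Proof.
elim: N => [|N IH]; first by rewrite big_ord0 big1// => i _; rewrite subrr.
rewrite big_ord_recr/= IH.
have -> : a (N + q)%N - a N = \sum_(i < q) (a (N + i).+1 - a (N + i)%N).
  rewrite -(big_mkord xpredT (fun i => a (N + i).+1 - a (N + i)%N)).
  under eq_bigr do rewrite -addnS.
  by rewrite (telescope_sumr (fun i => a (N + i)%N))// addn0.
by rewrite -big_split; apply: eq_bigr => i _ /=; rewrite addrC addrA subrK addSn.
Qed.

Theorem transport_inequality : 0 <= beta ->
  2 * m%:R * ('E (fun x => D x * G x) - 'E G) <=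
  w * (g%:R * Num.sqrt (n%:R * (2 * m)%:R * ln B / 2)
       + 2 * \sum_(j < m) Num.sqrt (n%:R * j.+1%:R * ln B / 2))
  + B * beta * (w * (4 * m%:R * (n - m)%:R - m%:R * (m%:R - 1))).
Proof.
move=> beta0.
pose a k := 'E (fun x => dens k x * G x).
have a0 k : (k <= S)%N -> a k = 'E G.
  by move=> kS; apply: eq_bigr => x _; rewrite dens_triv// mul1r.
have an k : (n + S <= k)%N -> a k = 'E (fun x => D x * G x).
  exact: expect_cexp_full.
(* The sum telescopes to [2 m] terms beyond the sequence, where [dens] has become [D], minus [2 m]
   terms before it, where [dens] is 1. *)
have -> : 2 * m%:R * ('E (fun x => D x * G x) - 'E G) =
    \sum_(c < n + S) (a (c + 2 * m)%N - a c).
  rewrite sum_shift_diff.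
  rewrite (eq_bigr (fun=> 'E (fun x => D x * G x) - 'E G)).
    by rewrite sumr_const card_ord -[RHS]mulr_natl natrM.
  by move=> i _; rewrite an ?leq_addr// a0//; have := ltn_ord i; nat_lia.
apply: le_trans; first by apply: ler_sum => c _; exact: center_step.
have split4 (A1 A2 A3 A4 : 'I_(n + S) -> R) : \sum_c (A1 c - A2 c + A3 c - A4 c) =
    \sum_c A1 c - \sum_c A2 c + \sum_c A3 c - \sum_c A4 c.
  by rewrite sumrB big_split/= sumrB.
have split (A1 A2 A3 A4 : 'I_(n + S) -> R) : \sum_c (A1 c + A2 c + A3 c + A4 c) =
    \sum_c A1 c + \sum_c A2 c + \sum_c A3 c + \sum_c A4 c.
  by rewrite !big_split.
rewrite split split4.
pose F1 k := err k (hole (k - m) (k + g)).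
pose F2 k := err k (hole k (k + m + g)).
pose F3 j k := err k (fun x => hole (k - j) (k + g) x - hole (k - j) (k + g).+1 x).
pose F4 j k := err k (fun x => hole k (k - j.+1 + m + g) x
                             - hole k.-1 (k - j.+1 + m + g) x).
have sub k u v : (u <= k)%N -> (k + g <= v)%N -> depends S (outside k (k + g)) (hole u v).
  move=> ak kb; apply: (@depends_sub _ _ _ _ (outside u v)); last exact: hole_depends.
  by move=> p; rewrite /outside; nat_lia.
have subB k u v u' v' : (u <= k)%N -> (k + g <= v)%N -> (u' <= k)%N -> (k + g <= v')%N ->
    depends S (outside k (k + g)) (fun x => hole u v x - hole u' v' x).
  by move=> h1 h2 h3 h4 x y xy; rewrite (sub _ _ _ h1 h2 _ _ xy) (sub _ _ _ h3 h4 _ _ xy).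
have e1 : \sum_(c < n + S) err (c + 2 * m) (hole (c + m) (c + 2 * m + g)) =
    \sum_(k < n + S) F1 k.
  rewrite -(@sum_shift F1 (2 * m)); [|nat_lia|].
    by apply: eq_bigr => c _; rewrite /F1 (_ : c + 2 * m - m = c + m)%N//; nat_lia.
  by move=> k hk; apply: err_triv => //; apply: sub; nat_lia.
have e3 : \sum_(c < n + S) \sum_(j < m) err (c + (m + j)) (fun x =>
         hole (c + m) (c + (m + j) + g) x - hole (c + m) (c + (m + j) + g).+1 x) =
    \sum_(k < n + S) \sum_(j < m) F3 j k.
  rewrite exchange_big [RHS]exchange_big/=; apply: eq_bigr => j _; have jm := ltn_ord j.
  rewrite -(@sum_shift (F3 j) (m + j)); [|nat_lia|].
    by apply: eq_bigr => c _; rewrite /F3 (_ : c + (m + j) - j = c + m)%N//; nat_lia.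
  by move=> k hk; apply: err_triv => //; apply: subB; nat_lia.
have e4 : \sum_(c < n + S) \sum_(j < m) err (c + j.+1) (fun x =>
         hole (c + j.+1) (c + m + g) x - hole (c + j) (c + m + g) x) =
    \sum_(k < n + S) \sum_(j < m) F4 j k.
  rewrite exchange_big [RHS]exchange_big/=; apply: eq_bigr => j _; have jm := ltn_ord j.
  rewrite -(@sum_shift (F4 j) j.+1); [|nat_lia|].
    by apply: eq_bigr => c _; rewrite /F4 addnK addnS.
  by move=> k hk; apply: err_triv => //; apply: subB; nat_lia.
rewrite e1 e3 e4.
have -> : \sum_(c < n + S) err c (hole c (c + m + g)) = \sum_(k < n + S) F2 k by [].
have := error_le beta0; rewrite split4 => herr.
have t1 : \sum_(c < n + S) \sum_(i < g) wt (c + (m + i)) * tv c (c + 2 * m) <=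
    w * (g%:R * Num.sqrt (n%:R * (2 * m)%:R * ln B / 2)).
  have -> : w * (g%:R * Num.sqrt (n%:R * (2 * m)%:R * ln B / 2)) =
      \sum_(i < g) w * Num.sqrt (n%:R * (2 * m)%:R * ln B / 2).
    by rewrite sumr_const card_ord -[RHS]mulr_natl mulrCA.
  rewrite exchange_big/=; apply: ler_sum => i _; have ig := ltn_ord i.
  have := @sum_wt_tv (m + i) 0 (2 * m) ltac:(nat_lia).
  by apply: le_trans; under [leRHS]eq_bigr do rewrite addn0.
have t3 : \sum_(c < n + S) \sum_(j < m) wt (c + j) * tv c (c + j.+1) <=
    w * \sum_(j < m) Num.sqrt (n%:R * j.+1%:R * ln B / 2).
  rewrite exchange_big/= mulr_sumr; apply: ler_sum => j _; have jm := ltn_ord j.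
  have := @sum_wt_tv j 0 j.+1 ltac:(nat_lia).
  by apply: le_trans; under [leRHS]eq_bigr do rewrite addn0.
have t2 : \sum_(c < n + S) \sum_(j < m)
      wt (c + (m + g + j)) * tv (c + (m + j)) (c + 2 * m) <=
    w * \sum_(j < m) Num.sqrt (n%:R * j.+1%:R * ln B / 2).
  (* Reversing [j] turns the lengths [m - j] of the increments into [j + 1]. *)
  rewrite exchange_big/= mulr_sumr (reindex_inj rev_ord_inj)/=.
  apply: ler_sum => j _; have jm := ltn_ord j.
  have := @sum_wt_tv (m + g + (m - j.+1)) (m + (m - j.+1)) j.+1 ltac:(nat_lia).
  apply: le_trans; rewrite le_eqVlt; apply/orP; left; apply/eqP.
  by apply: eq_bigr => c _; congr (_ * tv _ _); nat_lia.
move: herr t1 t2 t3; rewrite /F1 /F2 /F3 /F4 => herr t1 t2 t3.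
clear split split4 sub subB e1 e3 e4; lra.
Qed.

End transport.

(** * Tail bound for finitely many letters *)

Section finite_tail.
Context {R : realType}.

(** The induction step, multiplied by [sqrt m + sqrt (m + 1)], reads
    [(sqrt (m + 1) - sqrt m)^2 / 6 >= 0]. *)
Lemma sum_sqrt_le m : \sum_(j < m) Num.sqrt (j.+1%:R : R) <=
  (2 / 3 * m%:R + 1 / 2) * Num.sqrt m%:R.
Proof.
elim: m => [|m IH]; first by rewrite big_ord0 sqrtr0 mulr0.
rewrite big_ord_recr/=; apply: (le_trans (lerD IH (lexx _))).
set a := Num.sqrt m%:R; set b := Num.sqrt m.+1%:R.
have a2 : a ^+ 2 = m%:R by rewrite sqr_sqrtr.
have b2 : b ^+ 2 = a ^+ 2 + 1 by rewrite a2 sqr_sqrtr// natr1.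
have a0 : 0 <= a by rewrite sqrtr_ge0.
have b0 : 0 < b by rewrite sqrtr_gt0.

have -> : m.+1%:R = a ^+ 2 + 1 :> R by rewrite a2 natr1.
rewrite -a2 -subr_ge0 -(@pmulr_rge0 _ (a + b)); last by lra.
match goal with |- is_true (0 <= ?t) => have -> : t = 1 / 6 * (b - a) ^+ 2
   + (b ^+ 2 - (a ^+ 2 + 1)) * (2 / 3 * a ^+ 2) end.
  by field.
rewrite b2; have := sqr_ge0 (b - a); lra.
Qed.

Theorem finite_tail (K : finType) (n m mu : nat)
    (P G : {ffun 'I_n -> K} -> R) (eps beta : R) :
  (0 < m)%N -> (2 <= mu)%N -> (2 * m * mu <= n)%N ->
  (forall x, 0 <= P x) -> \sum_x P x = 1 ->
  (forall x, 0 <= G x <= 2) ->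
  (forall (x y : {ffun 'I_n -> K}) i, (forall j, j != i -> x j = y j) ->
    G x <= G y + 2 / n%:R) ->
  0 <= beta ->
  (forall k, (0 < k)%N -> (k + m.-1 < n)%N -> forall A : {set {ffun 'I_n -> K}},
    depends 0 (outside k (k + m.-1)) (fun x => (x \in A)%:R : R) ->
    \sum_(x in A) P x <=
      indep_expect 0 P k (fun=> 1) (fun x => (x \in A)%:R) + beta) ->
  expect P G < eps ->
  \sum_(x | eps < G x) P x <=
    2 * expR (- (mu%:R * (eps - expect P G) ^+ 2 / 2)) + (2 * mu)%:R * beta.
Proof.
move=> m0 mu2 mn P0 P1 G02 lipG beta0 mix Geps.
set p := \sum_(x | _) P x; set e := eps - expect P G.
have e0 : 0 < e by rewrite subr_gt0.
have rhs0 : 0 <= 2 * expR (- (mu%:R * e ^+ 2 / 2)) + (2 * mu)%:R * beta.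
  by rewrite addr_ge0 ?mulr_ge0 ?expR_ge0.
have p0 : 0 <= p by rewrite sumr_ge0.
have [->//|pn0] := eqVneq p 0.
have {pn0}p0 : 0 < p by rewrite lt_neqAle eq_sym pn0.
have EG0 : 0 <= expect P G.
  by rewrite sumr_ge0// => x _; rewrite mulr_ge0//; case/andP: (G02 x).
have e2 : e <= 2.
  suff : eps <= 2 by rewrite /e; move: EG0; clear; lra.
  rewrite leNgt; apply/negP => eps2; move: p0; rewrite /p big1 ?ltxx// => x.
  by case/andP: (G02 x) => _ /le_lt_trans /(_ eps2) /lt_trans h /h; rewrite ltxx.
have pE : p = expect P (fun x => (eps < G x)%R%:R).
  rewrite /p /expect big_mkcond; apply: eq_bigr => x _.
  by case: ifP; rewrite ?mulr1 ?mulr0.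
have pGle : p * eps <= expect P (fun x => (eps < G x)%R%:R * G x).
  rewrite pE /expect mulr_suml; apply: ler_sum => x _.
  rewrite -mulrA ler_wpM2l//; case: ltP => [/ltW|_]; last by rewrite !mul0r.
  by rewrite !mul1r.
(* If [p] were 1, the mean of [G] would be at least [eps]. Strictness gives [1 < B] for
   [B = 1 / p]. *)
have p1 : p < 1.
  rewrite lt_neqAle; apply/andP; split; last first.
    by rewrite -P1 pE /expect; apply: ler_sum => x _; rewrite ler_piMr// lern1 leq_b1.
  apply/eqP => pp; move: Geps; rewrite ltNge -[eps]mul1r -pp => /negP; apply.
  apply: (le_trans pGle); apply: ler_expect => // x _.
  by rewrite ler_piMl ?lern1 ?leq_b1//; case/andP: (G02 x).
have n0 : (0 < n)%N by rewrite (leq_trans _ mn)// !muln_gt0 m0/= (ltn_trans _ mu2).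
have mn2 : (2 * m <= n)%N by rewrite (leq_trans _ mn)// leq_pmulr// (ltn_trans _ mu2).
pose D x := (eps < G x)%R%:R / p.
have D0 x : 0 <= D x by rewrite divr_ge0// ltW.
have DB x : D x <= p^-1 by rewrite ler_piMl ?invr_ge0 ?(ltW p0)// lern1 leq_b1.
have Dmean : expect P D = 1.
  transitivity (p^-1 * expect P (fun x => (eps < G x)%R%:R)).
    by rewrite -expectZ; apply: eq_bigr => x _; rewrite /D [_ / p]mulrC.
  by rewrite -pE mulVf// gt_eqF.
have B1 : 1 < p^-1 by rewrite invf_gt1.
have w0 : 0 <= 2 / n%:R :> R by rewrite divr_ge0.
have mix' k : (3 * m < k)%N -> (k + m.-1 < n + 3 * m)%N ->
    forall A : {set {ffun 'I_n -> K}},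
    depends (3 * m) (outside k (k + m.-1)) (fun x => (x \in A)%:R : R) ->
    \sum_(x in A) P x <=
      indep_expect (3 * m) P k (fun=> 1) (fun x => (x \in A)%:R) + beta.
  move=> kS kn A Ad.
  have -> : indep_expect (3 * m) P k (fun=> 1) (fun x => (x \in A)%:R) =
      indep_expect 0 P (k - 3 * m) (fun=> 1) (fun x => (x \in A)%:R).
    apply: eq_bigr => x _; apply: eq_bigr => y _; congr (_ * (_ * _)).
    suff -> : splice (3 * m) k x y = splice 0 (k - 3 * m) x y by [].
    by apply/ffunP => i; rewrite !ffunE addn0 ltn_subRL addnC.
  apply: mix; [by move: kS; clear; lia|by move: kS kn; clear; lia|].
  move=> x y /agreeP xy; apply: Ad; apply/agreeP => i io; apply: xy.
  by move: io kS; rewrite /outside addn0; clear; lia.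
have h := transport_inequality m0 mn2 P P0 P1 G (2 / n%:R) w0 lipG D p^-1 beta D0 DB
  Dmean B1 mix' beta0.
have EDG : eps <= expect P (fun x => D x * G x).
  rewrite -(ler_pM2l p0); apply: le_trans pGle _.
  rewrite -expectZ le_eqVlt; apply/orP; left; apply/eqP.
  by apply: eq_bigr => x _; rewrite /D mulrAC [_ * (_ / p)]mulrCA divff ?gt_eqF// mulr1.
apply: (@tail_of_deviation _ m mu n p beta e) => //.
- by rewrite p0 ltW.
- by rewrite e2 ltW.
have M0 : 0 < m%:R :> R by rewrite ltr0n.
have N0 : 0 < n%:R :> R by rewrite ltr0n.
have L0 : 0 <= - ln p by rewrite oppr_ge0 ln_le0// ltW.
have mn1 : (m <= n)%N by rewrite (leq_trans _ mn2)// leq_pmull.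
set q := Num.sqrt _.
have q0 : 0 <= q by rewrite sqrtr_ge0.
have q2 : q ^+ 2 = m%:R / n%:R / 2 * - ln p.
  by rewrite sqr_sqrtr// mulr_ge0// !divr_ge0.
have sqrtE x y : 0 <= x -> 0 <= y -> x = y ^+ 2 -> Num.sqrt x = y.
  by move=> _ y0 ->; rewrite sqrtr_sqr ger0_norm.
have s1 : Num.sqrt (n%:R * (2 * m)%:R * ln p^-1 / 2) = Num.sqrt 2 * n%:R * q.
  have -> : n%:R * (2 * m)%:R * ln p^-1 / 2 = (Num.sqrt 2 * n%:R * q) ^+ 2.
    rewrite !exprMn q2 sqr_sqrtr// lnV ?posrE// natrM; field.
    by rewrite gt_eqF.
  by rewrite sqrtr_sqr ger0_norm// !mulr_ge0// sqrtr_ge0.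
have s2 : \sum_(j < m) Num.sqrt (n%:R * j.+1%:R * ln p^-1 / 2) <=
    (2 / 3 * m%:R + 1 / 2) * (n%:R * q).
  have -> : \sum_(j < m) Num.sqrt (n%:R * j.+1%:R * ln p^-1 / 2) =
      \sum_(j < m) Num.sqrt (n%:R * - ln p / 2) * Num.sqrt j.+1%:R.
    apply: eq_bigr => j _; rewrite -sqrtrM; last by rewrite divr_ge0// mulr_ge0.
    by rewrite lnV ?posrE//; congr Num.sqrt; ring.
  have -> : n%:R * q = Num.sqrt (n%:R * - ln p / 2) * Num.sqrt m%:R.
    rewrite -sqrtrM; last by rewrite divr_ge0// mulr_ge0.
    have -> : n%:R * - ln p / 2 * m%:R = (n%:R * q) ^+ 2.
      by rewrite exprMn q2; field; rewrite gt_eqF.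
    by rewrite sqrtr_sqr ger0_norm// mulr_ge0.
  by rewrite -mulr_sumr mulrCA ler_wpM2l ?sqrtr_ge0// sum_sqrt_le.
move: h; rewrite s1 natrB// -subn1 natrB// => h.
(* Divided by [2 m], this is exactly the hypothesis of [tail_of_deviation]. *)
have {}h : 2 * m%:R * e <= 2 / n%:R * ((m%:R - 1) * (Num.sqrt 2 * n%:R * q) +
     2 * ((2 / 3 * m%:R + 1 / 2) * (n%:R * q))) +
    p^-1 * beta * (2 / n%:R * (4 * m%:R * (n%:R - m%:R) - m%:R * (m%:R - 1))).
  apply: le_trans (le_trans h _).
    by rewrite ler_pM2l ?mulr_gt0// lerD2r.
  by rewrite lerD2r ler_pM2l ?divr_gt0// lerD2l ler_pM2l.
rewrite -(ler_pM2l (_ : 0 < 2 * m%:R)) ?mulr_gt0//; apply: (le_trans h).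
rewrite le_eqVlt; apply/orP; left; apply/eqP; field.
by rewrite !gt_eqF.
Qed.

End finite_tail.

(** * The L1 error as a function of the bins *)

Section bins.
Context {R : realType} {d : nat}.
Variables (o : d.-tuple R) (h : R).
Hypothesis h_gt0 : 0 < h.
Implicit Types (x y : d.-tuple R) (c : {ffun 'I_d -> int}).

Definition bin_index x : {ffun 'I_d -> int} :=
  [ffun i => Num.floor ((tnth x i - tnth o i) / h)].

Definition bin_corner c : d.-tuple R := [tuple tnth o i + h * (c i)%:~R | i < d].

Definition cell c : set (d.-tuple R) := bin_index @^-1` [set c].

Lemma binE x y : bin o h x y <-> bin_index x = bin_index y.
Proof.
split=> [e|e i]; first by apply/ffunP => i; rewrite !ffunE e.
by have := congr1 (fun c : {ffun 'I_d -> int} => c i) e; rewrite !ffunE.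
Qed.

Lemma bin_cornerK : cancel bin_corner bin_index.
Proof.
move=> c; apply/ffunP => i; rewrite ffunE tnth_mktuple addrAC subrr add0r.
by rewrite mulrAC divff ?gt_eqF// mul1r intrKfloor.
Qed.

Definition side c i : set R :=
  `[tnth o i + h * (c i)%:~R, tnth o i + h * (c i)%:~R + h[%classic.

Lemma cellE c : cell c = [set x | forall i, side c i (tnth x i)].
Proof.
have fl i x : (Num.floor ((tnth x i - tnth o i) / h) == c i) =
    (tnth o i + h * (c i)%:~R <= tnth x i < tnth o i + h * (c i)%:~R + h).
  rewrite floor_eq ler_pdivlMr// ltr_pdivrMr// lerBrDl ltrBlDl intrD mulrDl.
  by rewrite mul1r ![_%:~R * h]mulrC addrA.
apply/seteqP; split => x /= xc.
  move=> i; rewrite /side/= in_itv/= -fl; apply/eqP.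
  by move: xc => /(congr1 (fun c : {ffun 'I_d -> int} => c i)); rewrite ffunE.
apply/ffunP => i; rewrite ffunE; apply/eqP; rewrite fl.
by have := xc i; rewrite /side/= in_itv.
Qed.

Lemma measurable_box (A : 'I_d -> set R) : (forall i, measurable (A i)) ->
  measurable [set x : d.-tuple R | forall i, A i (tnth x i)].
Proof.
move=> mA; rewrite (_ : mkset _ =
    \bigcap_(i in setT) ((@tnth d R) ^~ i @^-1` A i)).
  apply: fin_bigcap_measurable => // i _.
  by rewrite -[X in measurable X]setTI; exact: measurable_tnth.
by apply/seteqP; split => x /= H i => [_|]; exact: H.
Qed.

Lemma measurable_cell c : measurable (cell c).
Proof.
by rewrite cellE; apply: measurable_box => i; exact: measurable_itv.
Qed.

Lemma lebesgue_cell c : lebesgue_tuple d (cell c) = (h ^+ d)%:E.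
Proof.
rewrite cellE lebesgue_tuple_box; last by move=> i; exact: measurable_itv.
rewrite (eq_bigr (fun=> h%:E)).
  by rewrite prodEFin prodr_const card_ord.
move=> i _; rewrite lebesgue_measure_itv/= lte_fin ltrDl h_gt0.
by rewrite -EFinB addrAC subrr add0r.
Qed.

Section L1_error.
Variables (n : nat) (f : d.-tuple R -> R).
Hypothesis n_gt0 : (0 < n)%N.
Hypothesis mf : measurable_fun setT f.
Hypothesis f_ge0 : forall x, 0 <= f x.
Hypothesis f_int : (\int[lebesgue_tuple d]_x (f x)%:E = 1)%E.

Definition L1_error (x_ : 'I_n -> d.-tuple R) := L1_dist (histogram o h x_) f.

(** An observation is in the bin of [x] if and only if [x] is in the cell of the observation; the
    histogram thus becomes a sum of functions of [x] with integral [1/n]. *)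
Lemma histogramE (x_ : 'I_n -> d.-tuple R) x : histogram o h x_ x =
  \sum_(i < n) (n%:R * h ^+ d)^-1 * \1_(cell (bin_index (x_ i))) x.
Proof.
rewrite /histogram mulr_sumr; apply: eq_bigr => i _; congr (_ * _).
suff e : (x_ i \in bin o h x) = (x \in cell (bin_index (x_ i))) by rewrite !indicE e.
by apply/idP/idP => /set_mem e; apply/mem_set; [exact/esym/binE|exact/binE/esym].
Qed.

Lemma L1_error_bins (x_ y_ : 'I_n -> d.-tuple R) :
  (forall i, bin_index (x_ i) = bin_index (y_ i)) -> L1_error x_ = L1_error y_.
Proof.
move=> e; apply: eq_integral => x _; rewrite !histogramE.
by under eq_bigr do rewrite e.
Qed.

Let unit_mass c x : R := (n%:R * h ^+ d)^-1 * \1_(cell c) x.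

Let unit_mass_ge0 c x : 0 <= unit_mass c x.
Proof. by rewrite mulr_ge0// invr_ge0 mulr_ge0// exprn_ge0// ltW. Qed.

Let measurable_unit_mass c : measurable_fun setT (unit_mass c).
Proof.
by apply: measurable_funM => //; exact: (measurable_indic (measurable_cell c)).
Qed.

Let integral_unit_mass c : (\int[lebesgue_tuple d]_x (unit_mass c x)%:E = n%:R^-1%:E)%E.
Proof.
under eq_integral do rewrite EFinM.
rewrite ge0_integralZl//; last 2 first.
- apply/measurable_EFinP; exact: (measurable_indic (measurable_cell c)).
- by rewrite lee_fin invr_ge0 mulr_ge0// exprn_ge0// ltW.
rewrite integral_indic//; last exact: measurable_cell.
rewrite setIT [X in (_ * X)%E](lebesgue_cell c) -EFinM; congr (_%:E).
by rewrite invfM -mulrA mulVf ?mulr1// expf_neq0// gt_eqF.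
Qed.

Let measurable_histogram (x_ : 'I_n -> d.-tuple R) :
  measurable_fun setT (histogram o h x_).
Proof.
rewrite (_ : histogram o h x_ = fun x => \sum_(i < n) unit_mass (bin_index (x_ i)) x).
  by apply: measurable_sum => i; exact: measurable_unit_mass.
by apply/funext => x; rewrite histogramE.
Qed.

Let measurable_error (x_ : 'I_n -> d.-tuple R) :
  measurable_fun setT (fun x => `|histogram o h x_ x - f x|).
Proof. by apply/measurableT_comp => //; exact: measurable_funB. Qed.

Lemma L1_error_ge0 (x_ : 'I_n -> d.-tuple R) : (0 <= L1_error x_)%E.
Proof. by apply: integral_ge0 => x _; rewrite lee_fin. Qed.

(** The histogram and [f] are both nonnegative with integral 1. *)
Lemma L1_error_le2 (x_ : 'I_n -> d.-tuple R) : (L1_error x_ <= 2%:E)%E.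
Proof.
have hist0 x : 0 <= histogram o h x_ x.
  by rewrite histogramE; apply: sumr_ge0 => i _; exact: unit_mass_ge0.
have mhist : measurable_fun setT (EFin \o histogram o h x_).
  by apply/measurable_EFinP; exact: measurable_histogram.
have mfE : measurable_fun setT (EFin \o f) by exact/measurable_EFinP.
apply: (@le_trans _ _ (\int[lebesgue_tuple d]_x
    ((histogram o h x_ x)%:E + (f x)%:E))%E).
  apply: ge0_le_integral; first exact: measurableT.
  - by move=> x _; rewrite lee_fin.
  - by apply/measurable_EFinP; exact: measurable_error.
  - exact: emeasurable_funD.
  - move=> x _; rewrite -EFinD lee_fin (le_trans (ler_normB _ _))//.
    by rewrite !ger0_norm.
rewrite ge0_integralD; last 5 first.
- exact: measurableT.
- by move=> x _; rewrite lee_fin.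
- exact: mhist.
- by move=> x _; rewrite lee_fin.
- exact: mfE.
rewrite f_int; under eq_integral do rewrite histogramE -sumEFin.
rewrite ge0_integral_sum; last 3 first.
- exact: measurableT.
- by move=> i; apply/measurable_EFinP; exact: measurable_unit_mass.
- by move=> i x _; rewrite lee_fin unit_mass_ge0.
rewrite (eq_bigr (fun=> n%:R^-1%:E)); last by move=> i _; exact: integral_unit_mass.
by rewrite sumEFin sumr_const card_ord -[_ *+ n]mulr_natr mulVf ?pnatr_eq0 -?lt0n//.
Qed.

(** Changing one observation moves a mass [1/n] from one cell to another. *)
Lemma L1_error_lip (x_ y_ : 'I_n -> d.-tuple R) i :
  (forall j, j != i -> x_ j = y_ j) -> (L1_error x_ <= L1_error y_ + (2 / n%:R)%:E)%E.
Proof.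
move=> xy.
have mm c : measurable_fun setT (EFin \o unit_mass c).
  by apply/measurable_EFinP; exact: measurable_unit_mass.
have me : measurable_fun setT (fun x => `|histogram o h y_ x - f x|%:E).
  by apply/measurable_EFinP; exact: measurable_error.
pose u x := unit_mass (bin_index (x_ i)) x; pose v x := unit_mass (bin_index (y_ i)) x.
apply: (@le_trans _ _ (\int[lebesgue_tuple d]_x
    (`|histogram o h y_ x - f x|%:E + ((u x)%:E + (v x)%:E)))%E).
  apply: ge0_le_integral; first exact: measurableT.
  - by move=> x _; rewrite lee_fin.
  - by apply/measurable_EFinP; exact: measurable_error.
  - by apply: emeasurable_funD => //; apply: emeasurable_funD; exact: mm.
  - move=> x _; rewrite -!EFinD lee_fin.
    have -> : histogram o h x_ x - f x = (histogram o h y_ x - f x) + (u x - v x).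
      rewrite !histogramE (bigD1 i)//= [X in _ = X - _ + _](bigD1 i)//=.
      rewrite (eq_bigr (fun j => (n%:R * h ^+ d)^-1 * \1_(cell (bin_index (y_ j))) x)).
        set s := \sum_(_ < _ | _) _.
        rewrite /u /v /unit_mass; ring.
      by move=> j ji; rewrite xy.
    rewrite (le_trans (ler_normD _ _))// lerD2l (le_trans (ler_normB _ _))//.
    by rewrite !ger0_norm// unit_mass_ge0.
rewrite ge0_integralD; last 5 first.
- exact: measurableT.
- by move=> x _; rewrite lee_fin.
- exact: me.
- by move=> x _; rewrite -EFinD lee_fin addr_ge0// unit_mass_ge0.
- by apply: emeasurable_funD; exact: mm.
rewrite leeD2l// ge0_integralD; last 5 first.
- exact: measurableT.
- by move=> x _; rewrite lee_fin unit_mass_ge0.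
- exact: mm.
- by move=> x _; rewrite lee_fin unit_mass_ge0.
- exact: mm.
rewrite !integral_unit_mass -EFinD lee_fin; lra.
Qed.

End L1_error.
End bins.

(** * Reduction to finitely many bins *)

Section finite_law.
Context {R : realType} {d0} {Omega : measurableType d0} (P : probability Omega R).
Context {T : finType} (Z : Omega -> T).
Hypothesis mZ : forall x, measurable (Z @^-1` [set x]).

Definition law x : R := fine (P (Z @^-1` [set x])).

Lemma law_ge0 x : 0 <= law x.
Proof. exact: fine_ge0. Qed.

Lemma EFin_law x : (law x)%:E = P (Z @^-1` [set x]).
Proof. by rewrite fineK// fin_num_measure. Qed.

Lemma comp_indicE (u : T -> R) w :
  u (Z w) = \sum_x u x * \1_(Z @^-1` [set x]) w.
Proof.
rewrite (bigD1 (Z w))//= indicE mem_set// mulr1 big1 ?addr0// => x xZ.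
rewrite indicE memNset ?mulr0// => /= e.
by rewrite e eqxx in xZ.
Qed.

Lemma measurable_comp_finite (u : T -> R) : measurable_fun setT (u \o Z).
Proof.
rewrite (_ : u \o Z = fun w => \sum_x u x * \1_(Z @^-1` [set x]) w).
  by apply: measurable_sum => x; apply: measurable_funM => //; exact: measurable_indic.
by apply/funext => w; rewrite /= comp_indicE.
Qed.

Lemma integral_law (u : T -> R) : (forall x, 0 <= u x) ->
  (\int[P]_w (u (Z w))%:E = (\sum_x law x * u x)%:E)%E.
Proof.
move=> u0; under eq_integral do rewrite comp_indicE -sumEFin.
have mi x : measurable_fun setT (EFin \o (\1_(Z @^-1` [set x]) : Omega -> R)).
  by apply/measurable_EFinP; exact: measurable_indic.
rewrite ge0_integral_sum; last 3 first.
- exact: measurableT.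
- move=> x; apply/measurable_EFinP; exact: measurable_funM.
- by move=> x w _; rewrite lee_fin mulr_ge0.
rewrite -sumEFin; apply: eq_bigr => x _.
under eq_integral do rewrite EFinM.
rewrite ge0_integralZl//; [|exact: mi|by rewrite lee_fin].
by rewrite integral_indic// setIT [X in (_ * X)%E](esym (EFin_law x)) -EFinM mulrC.
Qed.

Lemma measurable_preimage_finite (S : pred T) : measurable [set w | S (Z w)].
Proof.
rewrite (_ : mkset _ = \bigcup_(x in [set x | S x]) (Z @^-1` [set x])).
  apply: fin_bigcup_measurable => //; exact: finite_finset.
apply/seteqP; split => [w Sw|w [x /= Sx Zw]]; first by exists (Z w).
by rewrite Zw.
Qed.

Lemma probability_law (S : pred T) : P [set w | S (Z w)] = (\sum_(x | S x) law x)%:E.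
Proof.
have mS := measurable_preimage_finite S.
rewrite -[X in P X]setIT -integral_indic// big_mkcond/=.
rewrite (eq_bigr (fun x => law x * (S x)%:R)); last first.
  by move=> x _; case: (S x); rewrite ?mulr1 ?mulr0.
rewrite -integral_law//; apply: eq_integral => w _; rewrite indicE.
by case: (boolP (S (Z w))) => h; [rewrite mem_set|rewrite memNset//; exact/negP].
Qed.

Lemma law_sum1 : \sum_x law x = 1.
Proof.
apply: EFin_inj; rewrite -(probability_law xpredT) -(@probability_setT _ _ _ P).
by congr (P _); apply/seteqP.
Qed.

End finite_law.

(** * Limits of bounded, eventually constant sequences of random variables *)

Section stationary_limit.
Context {R : realType} {d0} {Omega : measurableType d0} (P : probability Omega R).
Variables (u_ : nat -> Omega -> R) (u : Omega -> R) (c : R).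
Hypothesis mu_ : forall k, measurable_fun setT (u_ k).
Hypothesis u_c : forall k w, 0 <= u_ k w <= c.
Hypothesis u_u : forall w, \forall k \near \oo, u_ k w = u w.

Lemma measurable_limit : measurable_fun setT u.
Proof.
by apply: (measurable_fun_cvg mu_) => w _; apply: cvg_near_cst; exact: u_u.
Qed.

Lemma integral_limit_cvg :
  (\int[P]_w (u_ k w)%:E)%E @[k --> \oo] --> (\int[P]_w (u w)%:E)%E.
Proof.
have [] := @dominated_convergence _ Omega R P setT measurableT
  (fun k w => (u_ k w)%:E) (fun w => (u w)%:E) (EFin \o cst c) => //.
- by move=> k; apply/measurable_EFinP.
- by apply/measurable_EFinP; exact: measurable_limit.
- by apply: aeW => w _; apply: cvg_near_cst; near=> k; congr EFin; near: k; exact: u_u.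
- exact: finite_measure_integrable_cst.
- apply: aeW => w k _ /=; rewrite lee_fin; have /andP[a b] := u_c k w.
  by rewrite ger0_norm.
Unshelve. all: by end_near. Qed.

End stationary_limit.

Section law_map.
Context {R : realType} {d0} {Omega : measurableType d0} (P : probability Omega R).
Context {T U : finType} (Z : Omega -> T) (h : T -> U).
Hypothesis mZ : forall x, measurable (Z @^-1` [set x]).

Lemma measurable_fiber_comp y : measurable ((h \o Z) @^-1` [set y]).
Proof.
rewrite (_ : _ @^-1` _ = [set w | h (Z w) == y]).
  exact: (measurable_preimage_finite _ mZ (fun x => h x == y)).
by apply/seteqP; split => w /= => [->|/eqP].
Qed.

Lemma sum_law_comp (u : U -> R) : (forall y, 0 <= u y) ->
  \sum_y law P (h \o Z) y * u y = \sum_x law P Z x * u (h x).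
Proof.
move=> u0; apply: EFin_inj.
rewrite -(integral_law _ _ mZ (u \o h)); last by move=> x; exact: u0.
by rewrite -(integral_law _ _ measurable_fiber_comp).
Qed.

End law_map.

Section law_pair.
Context {R : realType} {d1 d2} {Om1 : measurableType d1} {Om2 : measurableType d2}.
Context (P1 : probability Om1 R) (P2 : probability Om2 R).
Context {T1 T2 : finType} (Z1 : Om1 -> T1) (Z2 : Om2 -> T2).
Hypothesis mZ1 : forall x, measurable (Z1 @^-1` [set x]).
Hypothesis mZ2 : forall x, measurable (Z2 @^-1` [set x]).

Let Z (w : Om1 * Om2) := (Z1 w.1, Z2 w.2).

Let ZE x : Z @^-1` [set x] = (Z1 @^-1` [set x.1]) `*` (Z2 @^-1` [set x.2]).
Proof. case: x => x y; apply/seteqP; split => -[w v] /=; rewrite /Z/=.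
  by case=> -> ->.
by case=> /= -> ->. Qed.

Lemma measurable_preimage_pair (S : T1 -> pred T2) :
  measurable [set w : Om1 * Om2 | S (Z1 w.1) (Z2 w.2)].
Proof.
apply: (measurable_preimage_finite Z _ (fun x => S x.1 x.2)) => x.
by rewrite ZE; exact: measurableX.
Qed.

Lemma product_law (S : T1 -> pred T2) :
  (P1 \x P2)%E [set w | S (Z1 w.1) (Z2 w.2)] =
  (\sum_x law P1 Z1 x * \sum_y law P2 Z2 y * (S x y)%:R)%:E.
Proof.
have mZ x : measurable (Z @^-1` [set x]) by rewrite ZE; exact: measurableX.
rewrite (probability_law (P1 \x P2)%E Z mZ (fun x => S x.1 x.2)); congr EFin.
rewrite big_mkcond/=; under [RHS]eq_bigr do rewrite mulr_sumr.
rewrite pair_big; apply: eq_bigr => -[x y] _ /=.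
have -> : law (P1 \x P2)%E Z (x, y) = law P1 Z1 x * law P2 Z2 y.
  rewrite /law -fineM ?fin_num_measure// -product_measure1E//; congr fine.
  exact: (congr1 (P1 \x P2)%E (ZE (x, y))).
by case: (S x y); rewrite ?mulr1 ?mulr0.
Qed.

End law_pair.

(** * Mixing of the process read through finitely many letters *)

Section discretized_process.
Context {R : realType} {d0} {Omega : measurableType d0} {P : probability Omega R}.
Context {d1} {E : measurableType d1} (X : int -> {RV P >-> E}).
Context {K : finType} (c : E -> K).
Hypothesis mc : forall x, measurable (c @^-1` [set x]).
Variables (n : nat).
Local Notation T := {ffun 'I_n -> K}.

Lemma measurable_coordinate (I : Type) (i : I) (B : set E) : measurable B ->
  measurable ([set p | B (p i)] : set (pathspace I E)).
Proof.
move=> mB; apply: sub_gen_smallest; exists i => //; exists B => //.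
by rewrite setTI.
Qed.

Definition word (I : Type) (t : 'I_n -> I) (p : pathspace I E) : T :=
  [ffun i => c (p (t i))].

Lemma measurable_word (I : Type) (t : 'I_n -> I) x :
  measurable (word I t @^-1` [set x]).
Proof.
rewrite (_ : _ @^-1` _ =
    \bigcap_(i in setT) [set p : pathspace I E | (c @^-1` [set x i]) (p (t i))]).
  apply: fin_bigcap_measurable; first exact: finite_finset.
  by move=> i _; exact: measurable_coordinate.
apply/seteqP; split => p /=.
  by move=> <- i _; rewrite ffunE.
by move=> h; apply/ffunP => i; rewrite ffunE; exact: h.
Qed.

Definition window (s : int) (w : Omega) : T := [ffun i : 'I_n => c (X (i.+1%:Z + s) w)].

Lemma windowE s : window s =
  word _ id \o trajectory X (fun i : 'I_n => i.+1%:Z + s).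
Proof. by apply/funext => w; apply/ffunP => i; rewrite !ffunE. Qed.

Lemma measurable_window s x : measurable (window s @^-1` [set x]).
Proof.
rewrite windowE comp_preimage -[X in measurable X]setTI.
by apply: measurable_trajectory => //; exact: measurable_word.
Qed.

Lemma law_window s : stationary X -> law P (window s) =1 law P (window 0).
Proof.
move=> stX x.
have E' r : law P (window r) x = fine (distribution P
    (trajectory X (fun i : 'I_n => i.+1%:Z + r)) (word _ id @^-1` [set x])).
  by rewrite /law windowE.
rewrite !E'; have -> : (fun i : 'I_n => i.+1%:Z + 0) = (fun i : 'I_n => i.+1%:Z).
  by apply/funext => i; rewrite addr0.
congr fine; exact: (stX n (fun i => i.+1%:Z) s _ (measurable_word _ _ x)).
Qed.

Section mixing.
Variables (m k : nat) (b : R) (k0 : K).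
Hypotheses (stX : stationary X) (betab : beta X m = b%:E).
Hypotheses (m_gt0 : (0 < m)%N) (k_gt0 : (0 < k)%N).
Local Notation g := m.-1.

(** Letters that cannot be read off the past, or off the future, are masked by [k0]; so the default
    times that [insubd] provides below have no effect. *)
Let before (x : T) : T := [ffun i : 'I_n => if (i < k)%N then x i else k0].
Let after (x : T) : T := [ffun i : 'I_n => if (i < k + g)%N then k0 else x i].

Let past_time (i : 'I_n) : {t : int | t <= 0} :=
  insubd (exist _ 0 isT) (i.+1%:Z - k%:Z).
Let future_time (i : 'I_n) : {t : int | m%:Z <= t} :=
  insubd (exist _ m%:Z (lexx _)) (i.+1%:Z - k%:Z).

Let before_past w : before (word _ past_time (past X w)) = before (window (- k%:Z) w).
Proof.
apply/ffunP => i; rewrite !ffunE; case: ifP => // ik.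
rewrite /past /trajectory val_insubd ifT//; move: ik; clear; lia.
Qed.

Let after_future w :
  after (word _ future_time (future X (a:=m) w)) = after (window (- k%:Z) w).
Proof.
apply/ffunP => i; rewrite !ffunE; case: ltnP => // ik.
rewrite /future /trajectory val_insubd ifT//; move: ik m_gt0; clear; lia.
Qed.

(** By stationarity the window can be shifted by [-k]. Its first [k] letters are then at times up to
    0 and those after the hole at times from [m] on, so [beta X m] compares their joint law with the
    product. *)
Lemma window_mixing (A : {set T}) :
  depends 0 (outside k (k + g)) (fun x => (x \in A)%:R : R) ->
  \sum_(x in A) law P (window 0) x <=
    indep_expect 0 (law P (window 0)) k (fun=> 1) (fun x => (x \in A)%:R) + b.
Proof.
move=> Ad.
have AE x y : agree 0 (outside k (k + g)) x y -> (x \in A) = (y \in A).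
  by move=> /Ad; case: (x \in A); case: (y \in A) => // /eqP;
    rewrite ?oner_eq0// eq_sym oner_eq0.
(* Masked letters are either discarded by [splice] or lie in the hole, on which [A] does not
   depend. *)
have mask x y : (splice 0 k (before x) (after y) \in A) = (splice 0 k x y \in A).
  apply: AE; apply/agreeP => i; rewrite /outside !ffunE addn0 => io.
  case: ltnP => // ik; case: ltnP => // ikg.
  by move: io ik ikg; clear; lia.
have mask1 x : (splice 0 k (before x) (after x) \in A) = (x \in A).
  by rewrite mask; congr (_ \in A); apply/ffunP => i; rewrite ffunE if_same.
pose Z1 := before \o word _ past_time; pose Z2 := after \o word _ future_time.
have mZ1 x : measurable (Z1 @^-1` [set x]).
  by apply: measurable_fiber_comp; exact: measurable_word.
have mZ2 x : measurable (Z2 @^-1` [set x]).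
  by apply: measurable_fiber_comp; exact: measurable_word.
pose S x y := splice 0 k x y \in A.
pose U := [set w : pathspace {t : int | t <= 0} E * pathspace {t : int | m%:Z <= t} E |
  S (Z1 w.1) (Z2 w.2)].
have mU : measurable U by exact: measurable_preimage_pair.
have joint : distribution P (past_future X m) U = (\sum_(x in A) law P (window 0) x)%:E.
  rewrite -(eq_bigr _ (fun x _ => law_window (- k%:Z) stX x)).
  rewrite -(probability_law P _ (measurable_window _) (fun x => x \in A)).
  congr (P _); apply/seteqP; split => w;
    by rewrite /U /past_future /S /Z1 /Z2 /= before_past after_future mask1.
have prod : (distribution P (past X) \x distribution P (future X (a:=m)))%E U =
    (indep_expect 0 (law P (window 0)) k (fun=> 1) (fun x => (x \in A)%:R))%:E.
  rewrite (product_law _ _ _ _ mZ1 mZ2 S); congr EFin.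
  have e1 x : law (distribution P (past X)) Z1 x =
      law P (before \o window (- k%:Z)) x.
    congr (fine (P _)); apply/seteqP; split => w /=; by rewrite /Z1/= before_past.
  have e2 x : law (distribution P (future X (a:=m))) Z2 x =
      law P (after \o window (- k%:Z)) x.
    congr (fine (P _)); apply/seteqP; split => w /=; by rewrite /Z2/= after_future.
  have mw := measurable_window (- k%:Z).
  under eq_bigr => x _.
    rewrite e1; under eq_bigr do rewrite e2.
    rewrite (sum_law_comp _ _ _ mw (fun y => (S x y)%:R)); last by [].
    over.
  rewrite (sum_law_comp _ _ _ mw (fun x => \sum_y law P (window (- k%:Z)) y *
    (S x (after y))%:R)); last first.
    by move=> x; apply: sumr_ge0 => y _; rewrite mulr_ge0// law_ge0.
  apply: eq_bigr => x _; rewrite mulr_sumr; apply: eq_bigr => y _.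
  by rewrite !law_window// mul1r mulrA /S mask.
have : (`|(distribution P (past X) \x distribution P (future X (a:=m))) U -
    distribution P (past_future X m) U| <= b%:E)%E.
  by rewrite -betab; apply: ereal_sup_ubound; exists U.
rewrite joint prod -EFinB abse_EFin lee_fin => /ler_normlP[+ _].
by rewrite opprB lerBlDl.
Qed.

End mixing.
End discretized_process.

(** The exponent is cut into four parts whose exponentials are at least [1], [2 (1 - u)], [1/2] and
    [1/2]. With [u = eps1 / 2] this serves the case [mu = 1]. *)
Lemma expR_markov {R : realType} (u : R) : 0 <= u <= 1 ->
  1 - u <= 2 * expR (- (2 * u ^+ 2)).
Proof.
move=> /andP[u0 u1].
have uu : u ^+ 2 <= u by rewrite expr2 ler_piMr.
have -> : - (2 * u ^+ 2) = 2 * (u - u ^+ 2) + (1 - 2 * u) + - 2^-1 + - 2^-1 by field.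
have e1 : 1 <= expR (2 * (u - u ^+ 2)).
  by rewrite -expR0 ler_expR mulr_ge0// subr_ge0.
have e2 := expR_ge1Dx (1 - 2 * u).
have e3 := expR_ge1Dx (- 2^-1 : R).
rewrite 3!expRD -!mulrA.
have e4 : 2^-1 * 2^-1 <= expR (- 2^-1 : R) * expR (- 2^-1).
  by apply: ler_pM => //; move: e3; lra.
have [h|h] := leP (1 - u) 0; first by apply: (le_trans h); rewrite !mulr_ge0 ?expR_ge0.
have e5 : (1 - u) * 2 * (2^-1 * 2^-1) <=
    expR (1 - 2 * u) * (expR (- 2^-1 : R) * expR (- 2^-1)).
  by apply: ler_pM => //; [rewrite mulr_ge0// ltW|move: e2; lra].
have e6 := expR_ge0 (1 - 2 * u); have e7 := expR_ge0 (- 2^-1 : R).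
apply: (@le_trans _ _ (2 * (expR (1 - 2 * u) * (expR (- 2^-1 : R) * expR (- 2^-1))))).
  by move: e5; lra.
by rewrite ler_pM2l// ler_peMl// !mulr_ge0.
Qed.

(** * The mixing coefficient at lag 0 *)

Section beta_zero.
Context {R : realType} {d0} {Omega : measurableType d0} (P : probability Omega R).
Context {d : nat} (X : int -> {RV P >-> d.-tuple R}) (f : d.-tuple R -> R).
Hypothesis density : is_density (distribution P (X 0)) f.

Lemma density_hyperplane (i : 'I_d) (a : R) :
  P [set w | tnth (X 0 w) i = a] = 0%E.
Proof.
have [mf f0 /(_ [set x | tnth x i = a])] := density.
pose A j : set R := if j == i then [set a] else setT.
have AE : [set x : d.-tuple R | tnth x i = a] = [set x | forall j, A j (tnth x j)].
  apply/seteqP; split => x /=.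
    by move=> xa j; rewrite /A; case: eqP => // ->.
  by move=> /(_ i); rewrite /A eqxx.
have mA j : measurable (A j) by rewrite /A; case: ifP.
have mS : measurable [set x : d.-tuple R | tnth x i = a].
  by rewrite AE; exact: measurable_box.
move=> /(_ mS); rewrite /distribution/= /pushforward/= => ->.
apply: null_set_integral => //.
  by apply/measurable_EFinP; exact: measurable_funS mf.
rewrite AE; apply: (eq_trans (lebesgue_tuple_box mA)).
by rewrite (bigD1 i)//= {1}/A eqxx lebesgue_measure_set1 mul0e.
Qed.

(** Time 0 belongs to both past and future. That its two copies have the same [i]-th coordinate is
    certain under the joint law, but has probability 0 under the product, as hyperplanes are null
    sets. *)
Lemma beta0_ge1 (i : 'I_d) : (1 <= beta X 0)%E.
Proof.
pose S := pathspace {t : int | t <= 0} (d.-tuple R).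
pose S' := pathspace {t : int | 0%:Z <= t} (d.-tuple R).
pose a (p : S) : R := tnth (p (exist _ 0 isT)) i.
pose a' (q : S') : R := tnth (q (exist _ 0 isT)) i.
have coord (I : Type) (t : I) :
    measurable_fun setT (fun p : pathspace I (d.-tuple R) => tnth (p t) i).
  move=> _ B mB; rewrite setTI.
  apply: (measurable_coordinate I t ((@tnth d R)^~ i @^-1` B)).
  by rewrite -[X in measurable X]setTI; exact: measurable_tnth.
pose U := [set w : S * S' | a w.1 = a' w.2].
have mU : measurable U.
  rewrite (_ : U = setT `&` (fun w : S * S' => a w.1 - a' w.2) @^-1` [set 0]).
    apply: (measurable_funB (measurableT_comp (coord _ _) measurable_fst)
      (measurableT_comp (coord _ _) measurable_snd)) => //.
  rewrite setTI; apply/seteqP; split => w /=; first by move=> ->; rewrite subrr.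
  by move=> /eqP; rewrite subr_eq0 => /eqP.
have joint : distribution P (past_future X 0) U = 1%E.
  rewrite -(@probability_setT _ _ _ P); congr (P _).
  by apply/seteqP; split => w.
have prod : (distribution P (past X) \x distribution P (future X (a:=0)))%E U = 0%E.
  apply: integral0_eq => p _ /=.
  rewrite -[RHS](density_hyperplane i (a p)); congr (P _).
  by apply/seteqP; split => w; rewrite /xsection/= inE.
apply: ereal_sup_ubound; exists U => //.
by rewrite joint prod sub0e abseN abse1.
Qed.

End beta_zero.

(** * Numbering the bins *)

Section bin_codes.
Context {R : realType} {d : nat} (o : d.-tuple R) (h : R).
Hypothesis h_gt0 : 0 < h.
Local Notation C := {ffun 'I_d -> int}.

(** Bins with a number above [B] all get the letter 0, the default value of [inord]. *)
Definition bin_code B (x : d.-tuple R) : 'I_B.+1 := inord (pickle (bin_index o h x)).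

Definition bin_rep B (k : 'I_B.+1) : d.-tuple R :=
  bin_corner o h (odflt [ffun=> 0] (unpickle k : option C)).

Lemma measurable_bin_code B k : measurable (bin_code B @^-1` [set k]).
Proof.
rewrite (_ : _ @^-1` _ = \bigcup_(c : C)
    if inord (pickle c) == k then cell o h c else set0).
  apply: countable_bigcupT_measurable; first exact: countableP.
  by move=> c; case: ifP => // _; exact: measurable_cell.
apply/seteqP; split => x /=.
  by move=> xk; exists (bin_index o h x) => //; rewrite -xk eqxx.
by move=> [c _]; case: eqP => // <- <-.
Qed.

Lemma bin_repK B x : (pickle (bin_index o h x) <= B)%N ->
  bin_index o h (bin_rep B (bin_code B x)) = bin_index o h x.
Proof.
by move=> xB; rewrite /bin_rep bin_cornerK// /bin_code inordK// pickleK.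
Qed.

End bin_codes.

(** * Letting the number of bins tend to infinity *)

Section L1_tail.
Context {R : realType} {d0} {Omega : measurableType d0} {P : probability Omega R}.
Context {d : nat} (X : int -> {RV P >-> d.-tuple R}) (f : d.-tuple R -> R).
Variables (o : d.-tuple R) (h : R) (n : nat).
Hypotheses (stX : stationary X) (density : is_density (distribution P (X 0)) f).
Hypotheses (h_gt0 : 0 < h) (n_gt0 : (0 < n)%N).

Local Notation err := (L1_error o h n f).

Let mf : measurable_fun setT f. Proof. by case: density. Qed.

Let f_ge0 x : 0 <= f x. Proof. by case: density. Qed.

Let f_int : (\int[lebesgue_tuple d]_x (f x)%:E = 1)%E.
Proof.
by case: density => _ _ <- //; exact: probability_setT.
Qed.

Let errE x_ : (fine (err x_))%:E = err x_.
Proof.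
rewrite fineK// ge0_fin_numE ?L1_error_ge0//.
exact: le_lt_trans (L1_error_le2 o h h_gt0 n f n_gt0 mf f_ge0 f_int x_) (ltry _).
Qed.

Let err_bounds x_ : 0 <= fine (err x_) <= 2.
Proof.
rewrite -!lee_fin errE L1_error_ge0.
exact: (L1_error_le2 o h h_gt0 n f n_gt0 mf f_ge0 f_int x_).
Qed.

Definition sample_error w : R := fine (err (fun i => X i.+1 w)).

Let G {B} (z : {ffun 'I_n -> 'I_B.+1}) : R :=
  fine (err (fun i => bin_rep o h B (z i))).

Let G_lip B (x y : {ffun 'I_n -> 'I_B.+1}) i :
  (forall j, j != i -> x j = y j) -> G x <= G y + 2 / n%:R.
Proof.
move=> xy; have : (err (fun i => bin_rep o h B (x i)) <=
    err (fun i => bin_rep o h B (y i)) + (2 / n%:R)%:E)%E.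
  by apply: (L1_error_lip o h h_gt0 n f mf _ _ i) => j ji; rewrite xy.
have ex := errE (fun i => bin_rep o h B (x i)).
by have ey := errE (fun i => bin_rep o h B (y i)); rewrite -ex -ey -EFinD lee_fin.
Qed.

Let coded B := window X (bin_code o h B) n 0.

(** A sample meets finitely many bins, so its coding is faithful once [B] exceeds their numbers. *)
Let coded_error w : \forall B \near \oo, G (coded B w) = sample_error w.
Proof.
pose N := (\max_(i < n) pickle (bin_index o h (X i.+1 w)))%N.
exists N => // B /= NB; congr fine; apply: L1_error_bins => i.
rewrite /coded ffunE addr0 bin_repK//; apply: leq_trans NB.
exact: (@leq_bigmax _ (fun i : 'I_n => pickle (bin_index o h (X i.+1 w))) i).
Qed.

Let measurable_coded B x : measurable (coded B @^-1` [set x]).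
Proof. by apply: measurable_window => k; exact: measurable_bin_code. Qed.

Let measurable_coded_error B : measurable_fun setT (G \o coded B).
Proof. by apply: measurable_comp_finite => x; exact: measurable_coded. Qed.

Lemma measurable_sample_error : measurable_fun setT sample_error.
Proof.
by apply: (measurable_limit _ _ measurable_coded_error) => w; exact: coded_error.
Qed.

Lemma sample_error_bounds w : 0 <= sample_error w <= 2.
Proof. exact: err_bounds. Qed.

Lemma sample_errorE w : (sample_error w)%:E =
  L1_dist (histogram o h (fun i : 'I_n => X i.+1 w)) f.
Proof. exact: errE. Qed.

Lemma measurable_sample_tail eps : measurable [set w | eps < sample_error w].
Proof.
rewrite -[mkset _]setTI (_ : mkset _ = sample_error @^-1` `]eps, +oo[).
  by apply: measurable_sample_error => //; exact: measurable_itv.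
by apply/seteqP; split => w /=; rewrite in_itv/= andbT.
Qed.

Lemma mean_sample_error_fin : (\int[P]_w (sample_error w)%:E)%E \is a fin_num.
Proof.
rewrite ge0_fin_numE; last first.
  by apply: integral_ge0 => w _; rewrite lee_fin; case/andP: (sample_error_bounds w).
apply: (@le_lt_trans _ _ (\int[P]_w (cst 2%:E w))%E).
  apply: ge0_le_integral => //.
  - by move=> w _; rewrite lee_fin; case/andP: (sample_error_bounds w).
  - by apply/measurable_EFinP; exact: measurable_sample_error.
  - by move=> w _; rewrite lee_fin; case/andP: (sample_error_bounds w).
by rewrite integral_cst// [X in (_ * X)%E](@probability_setT _ _ _ P) mule1 ltry.
Qed.

Let coded_mean_cvg : expect (law P (coded B)) (@G B) @[B --> \oo] -->
  fine (\int[P]_w (sample_error w)%:E)%E.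
Proof.
rewrite (_ : (fun B => _) = fine \o (fun B => \int[P]_w (G (coded B w))%:E)%E).
  apply: fine_cvg; rewrite fineK ?mean_sample_error_fin//.
  apply: (integral_limit_cvg _ _ _ 2 measurable_coded_error) => w.
    by move=> v; exact: err_bounds.
  exact: coded_error.
apply/funext => B /=; rewrite (integral_law P (coded B) (measurable_coded B) (@G B))//.
by move=> z; case/andP: (err_bounds (fun i => bin_rep o h B (z i))).
Qed.

Let coded_tail_cvg eps : \sum_(z | eps < @G B z) law P (coded B) z @[B --> \oo] -->
  fine (P [set w | eps < sample_error w]).
Proof.
have mt := measurable_sample_tail eps.
pose v B w : R := (eps < G (coded B w))%R%:R.
rewrite (_ : (fun B => _) = fine \o (fun B => \int[P]_w (v B w)%:E)%E).
  apply: fine_cvg; rewrite fineK ?fin_num_measure//.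
  rewrite -[X in P X]setIT -integral_indic//.
  apply: (integral_limit_cvg P v _ 1).
  - move=> B; apply: (measurable_comp_finite _ (measurable_coded B)
      (fun z => (eps < G z)%R%:R)).
  - by move=> B w; rewrite ler0n lern1 leq_b1.
  - move=> w; apply: filterS (coded_error w) => B; rewrite /v => ->.
    rewrite indicE; case: ltP => h'; first by rewrite mem_set.
    by rewrite memNset//= => /lt_geF; rewrite h'.
apply/funext => B /=.
rewrite (integral_law P (coded B) (measurable_coded B) (fun z => (eps < G z)%R%:R))//.
rewrite big_mkcond; apply: eq_bigr => z _.
by case: ifP; rewrite ?mulr1 ?mulr0.
Qed.

(** The coded means converge, hence are eventually below [eps]; from then on [finite_tail] applies,
    and both of its sides converge. *)
Lemma sample_error_tail (eps b : R) (m mu : nat) :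
  (0 < m)%N -> (2 <= mu)%N -> (2 * m * mu <= n)%N -> beta X m = b%:E ->
  let e := eps - fine (\int[P]_w (sample_error w)%:E)%E in 0 < e ->
  fine (P [set w | eps < sample_error w]) <=
    2 * expR (- (mu%:R * e ^+ 2 / 2)) + (2 * mu)%:R * b.
Proof.
move=> m0 mu2 mn betab e e0.
have b0 : 0 <= b.
  rewrite -lee_fin -betab; apply: ereal_sup_ubound; exists set0 => //.
  by rewrite !measure0 sub0e oppe0 abse0.
pose eB B := expect (law P (coded B)) (@G B).
have cvg_rhs : 2 * expR (- (mu%:R * (eps - eB B) ^+ 2 / 2)) + (2 * mu)%:R * b @[B --> \oo]
    --> 2 * expR (- (mu%:R * e ^+ 2 / 2)) + (2 * mu)%:R * b.
  apply: cvgD; last exact: cvg_cst.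
  apply: cvgMr; apply: (continuous_cvg _ (@continuous_expR R _)).
  apply: cvgN; apply: cvgMl; apply: cvgMr.
  rewrite expr2; under eq_fun do rewrite expr2.
  by apply: cvgM; apply: cvgB; (exact: cvg_cst || exact: coded_mean_cvg).
apply: (ler_cvg_to (coded_tail_cvg eps) cvg_rhs).
have : \forall B \near \oo, eB B < eps.
  by apply: (cvgr_lt _ coded_mean_cvg); move: e0; rewrite /e subr_gt0.
apply: filterS => B eBeps.
apply: (finite_tail _ _ m) => //.
- by move=> x; exact: law_ge0.
- by apply: law_sum1 => x; exact: measurable_coded.
- by move=> x; exact: err_bounds.
- exact: G_lip.
- move=> k _ _ A Ad; apply: (window_mixing X _ _ n m k b ord0 stX betab m0 A Ad).
  by move=> x; exact: measurable_bin_code.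
Qed.

End L1_tail.

(** * The tail bound, including small values of [mu] and [m] *)

Theorem theorem7 (R : realType) (dO : measure_display)
    (Omega : measurableType dO) (P : probability Omega R) (d : nat)
    (X : int -> {RV P >-> d.-tuple R}) (f : d.-tuple R -> R)
    (o : d.-tuple R) (h : R) (n : nat) :
  stationary X -> beta_mixing X ->
  is_density (distribution P (X 0)) f ->
  0 < h -> (0 < n)%N ->
  let L1_error (w : Omega) : \bar R :=
    L1_dist (histogram o h (fun i : 'I_n => X i.+1 w)) f in
  let mean_error : \bar R := (\int[P]_w L1_error w)%E in
  forall (eps : R) (m mu : nat),
  (mean_error < eps%:E)%E -> (2 * m * mu <= n)%N ->
  let eps1 : R := eps - fine mean_error in
  (P [set w | eps%:E < L1_error w] <=
    (2 * expR (- (mu%:R * eps1 ^+ 2 / 2)))%:E + (2 * mu)%:R%:E * beta X m)%E.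
Proof.
move=> stX _ dens h0 n0 L1_error mean_error eps m mu.
pose g := sample_error X f o h n.
have gE w : L1_error w = (g w)%:E.
  by rewrite /g (sample_errorE X f o h n dens h0 n0).
have meanE : mean_error = (\int[P]_w (g w)%:E)%E.
  by apply: eq_integral => w _; rewrite gE.
have fin_mean := mean_sample_error_fin X f o h n dens h0 n0.
have bounds := sample_error_bounds X f o h n dens h0 n0.
have mg := measurable_sample_error X f o h n h0.
have mt := measurable_sample_tail X f o h n h0 eps.
rewrite -/g in fin_mean bounds mg mt.
rewrite meanE => mean_eps mn; set eps1 := eps - _.
have -> : [set w | (eps%:E < L1_error w)%E] = [set w | eps < g w].
  by apply/seteqP; split => w /=; rewrite gE lte_fin.
have e0 : 0 < eps1 by rewrite subr_gt0 -lte_fin fineK.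
set p := P _; have p1 : (p <= 1)%E by exact: probability_le1.
have beta0 : (0 <= beta X m)%E.
  apply: ereal_sup_ubound; exists set0 => //.
  by rewrite !measure0 sub0e oppe0 abse0.
have suff1 (r : R) : r <= 2 * expR (- (mu%:R * eps1 ^+ 2 / 2)) -> (p <= r%:E)%E ->
    (p <= (2 * expR (- (mu%:R * eps1 ^+ 2 / 2)))%:E + (2 * mu)%:R%:E * beta X m)%E.
  move=> hr /le_trans; apply; rewrite -lee_fin in hr; apply: (le_trans hr).
  by rewrite leeDl// mule_ge0// lee_fin.
(* For [mu = 0] the bound is at least 2. For [mu = 1] either [eps >= 2] and the tail is empty, or
   Markov's inequality applies. *)
case: mu => [|[|mu]] in mn suff1 *; rewrite -/eps1.
- by apply: (suff1 1) => //; rewrite !mul0r oppr0 expR0 mulr1 ler1n.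
- have [eps2|eps2] := leP 2 eps.
    apply: (suff1 0); first by rewrite mulr_ge0 ?expR_ge0.
    rewrite /p (_ : mkset _ = set0) ?measure0//; apply/seteqP; split => w //=.
    move=> ew; have /andP[_ gw] := bounds w.
    by have := lt_le_trans (le_lt_trans eps2 ew) gw; rewrite ltxx.
  pose E := fine (\int[P]_w (g w)%:E)%E.
  have E0 : 0 <= E.
    by apply: fine_ge0; apply: integral_ge0 => w _; rewrite lee_fin; case/andP: (bounds w).
  have eps0 : 0 < eps by apply: le_lt_trans E0 _; rewrite -subr_gt0.
  have pE : (p <= (E / eps)%:E)%E.
    have : (eps%:E * p <= E%:E)%E.
      rewrite /E fineK// /p -[X in P X]setIT -integral_indic// -ge0_integralZl//; last 2 first.
      - by apply/measurable_EFinP; exact: measurable_indic.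
      - by rewrite lee_fin ltW.
      apply: ge0_le_integral => //.
      - by move=> w _; rewrite lee_fin mulr_ge0// ltW.
      - by apply/measurable_EFinP; apply: measurable_funM => //; exact: measurable_indic.
      - by apply/measurable_EFinP.
      - move=> w _; rewrite lee_fin indicE; have [gw|gw] := ltP eps (g w).
          by rewrite mem_set// mulr1 ltW.
        by rewrite memNset ?mulr0//=; [case/andP: (bounds w)|rewrite ltNge gw].
rewrite EFinM; move: p1; rewrite /p; case: (P _) => [r| |]//; last by move=> *; rewrite leNye.
    by rewrite -!EFinM !lee_fin ler_pdivlMr// mulrC.
(* [E / eps <= 1 - (eps - E) / 2] amounts to [(eps - E) (2 - eps) >= 0]. *)
apply: (suff1 _ _ pE); apply: (@le_trans _ _ (1 - eps1 / 2)).
    rewrite ler_pdivrMr// mulrBl mul1r /eps1 -/E.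
    have : 0 <= (eps - E) * (2 - eps) by rewrite mulr_ge0// subr_ge0 ltW// -subr_gt0.
    lra.
  have u01 : 0 <= eps1 / 2 <= 1.
    by rewrite divr_ge0 ?(ltW e0)//= ler_pdivrMr// mul1r /eps1 -/E; lra.
  have := expR_markov _ u01; rewrite mul1r expr_div_n.
  by have -> : 2 * (eps1 ^+ 2 / 2 ^+ 2) = eps1 ^+ 2 / 2 by field.
case: (posnP m) => [m0|m0].
  (* In dimension 0 there is a single point: the error is constant, equal to its mean and so below
     [eps]. In positive dimension [beta X 0 >= 1] makes the bound trivial. *)
  have [d0|d0] := posnP d.
    have tail0 : [set w | eps < g w] = set0.
      apply/seteqP; split => w //= ew; move: mean_eps.
      rewrite (_ : (\int[P]_v (g v)%:E)%E = (g w)%:E) ?lte_fin; last first.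
        rewrite (_ : (fun v => _) = cst (g w)%:E).
          by rewrite integral_cst// [X in (_ * X)%E](@probability_setT _ _ _ P) mule1.
        apply/funext => v; congr (fine _)%:E; apply: L1_error_bins => i.
        by apply/ffunP => j; case: j => j j0; exfalso; move: j0; rewrite d0.
      by move=> /(lt_trans ew); rewrite ltxx.
    by rewrite /p tail0 measure0 adde_ge0 ?mule_ge0// lee_fin mulr_ge0 ?expR_ge0.
  rewrite m0; apply: le_trans p1 _.
  have b1 := beta0_ge1 _ X f dens (Ordinal d0).
  apply: (@le_trans _ _ ((2 * mu.+2)%:R%:E * beta X 0)%E).
    rewrite -[leLHS]mule1; apply: lee_pmul => //.
    by rewrite lee_fin ler1n muln_gt0.
  by rewrite leeDr// lee_fin mulr_ge0 ?expR_ge0.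
case betaE : (beta X m) beta0 => [b| |]// _.
- have := sample_error_tail X f o h n stX dens h0 n0 eps b m mu.+2 m0 isT mn betaE e0.
  by rewrite -lee_fin EFinD EFinM fineK ?fin_num_measure.
- have -> : ((2 * mu.+2)%:R%:E * +oo = +oo :> \bar R)%E.
    by rewrite gt0_muley// lte_fin ltr0n.
  exact: leey.
Qed.
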